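(* Let $\mathbf{d}$ be a Turing degree with $\mathbf{d}\gg\mathbf{0}'$. Then for every computable sequence $\langle f_i:i\in\omega\rangle$ of functions $f_i:\omega\to\omega$ there is a sequence $A=\langle A_i:i\in\omega\rangle$, each $A_i$ an infinite thin set for $f_i$, such that $\deg(A)'\leq\mathbf{d}$. In particular, every such computable sequence has a low$_2$ such solution $A$ (i.e. $A''\equiv_T\emptyset''$).
   Context: A set $S\subseteq\omega$ is thin for $f:\omega\to\omega$ if there is $c\in\omega$ with $f(x)\neq c$ for all $x\in S$. For degrees $\mathbf{a},\mathbf{b}$, $\mathbf{a}\gg\mathbf{b}$ means every infinite subtree of $2^{<\omega}$ of degree $\mathbf{b}$ has an infinite path of degree at most $\mathbf{a}$. *)

(* Defs.v *)
From mathcomp Require Import all_boot.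
Set Implicit Arguments. Unset Strict Implicit. Unset Printing Implicit Defensive.

Definition nset := nat -> Prop.

(* Instructions (tag, r, j):
     tag = 0 : INC r                       (j ignored)
     tag = 1 : if R r = 0 then goto j else DEC r and continue
     tag >= 2: ORACLE r : R r := 1 if (R r) is in the oracle, else 0.
   The machine halts when the program counter is >= size of the program.
   Input in register 0 (others 0); output read from register 0. *)
Definition instr := (nat * nat * nat)%type.
Definition prog := seq instr.
Definition regs := nat -> nat.
Definition config := (nat * regs)%type.

Definition upd (R : regs) (r v : nat) : regs := fun k => if k == r then v else R k.
Definition init_regs (x : nat) : regs := fun k => if k == 0 then x else 0.

Inductive step (A : nset) (p : prog) : config -> config -> Prop :=
| step_inc pc R r j : pc < size p -> nth (0,0,0) p pc = (0, r, j) ->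
    step A p (pc, R) (pc.+1, upd R r (R r).+1)
| step_jz pc R r j : pc < size p -> nth (0,0,0) p pc = (1, r, j) -> R r = 0 ->
    step A p (pc, R) (j, R)
| step_dec pc R r j k : pc < size p -> nth (0,0,0) p pc = (1, r, j) -> R r = k.+1 ->
    step A p (pc, R) (pc.+1, upd R r k)
| step_orc_in pc R t r j : pc < size p -> nth (0,0,0) p pc = (t, r, j) -> 2 <= t ->
    A (R r) -> step A p (pc, R) (pc.+1, upd R r 1)
| step_orc_out pc R t r j : pc < size p -> nth (0,0,0) p pc = (t, r, j) -> 2 <= t ->
    ~ A (R r) -> step A p (pc, R) (pc.+1, upd R r 0).

Inductive runs (A : nset) (p : prog) : config -> config -> Prop :=
| runs_refl c : runs A p c c
| runs_step c1 c2 c3 : step A p c1 c2 -> runs A p c2 c3 -> runs A p c1 c3.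

Definition eval (A : nset) (p : prog) (x y : nat) : Prop :=
  exists pc R, size p <= pc /\ runs A p (0, init_regs x) (pc, R) /\ R 0 = y.

Definition halts (A : nset) (p : prog) (x : nat) : Prop :=
  exists pc R, size p <= pc /\ runs A p (0, init_regs x) (pc, R).

Definition Treducible (B A : nset) : Prop :=
  exists p : prog, forall x, (B x -> eval A p x 1) /\ (~ B x -> eval A p x 0).

Definition Tequiv (A B : nset) : Prop := Treducible A B /\ Treducible B A.

Definition fun_computable_in (f : nat -> nat) (A : nset) : Prop :=
  exists p : prog, forall x, eval A p x (f x).

Definition emptyset : nset := fun _ => False.

Definition jump (A : nset) : nset :=
  fun n => exists p : prog, unpickle n = Some p /\ halts A p n.

Definition infinite_set (X : nset) : Prop := forall n, exists m, n <= m /\ X m.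

Definition npair (i x : nat) : nat := pickle (i, x).

Definition seq_code (A : nat -> nset) : nset :=
  fun n => exists i x, n = npair i x /\ A i x.

Definition computable_fseq (f : nat -> nat -> nat) : Prop :=
  exists p : prog, forall i x, eval emptyset p (npair i x) (f i x).

Definition thin_for (S : nset) (f : nat -> nat) : Prop :=
  exists c, forall x, S x -> f x <> c.

Definition is_tree (T : seq bool -> Prop) : Prop :=
  forall s n, T s -> T (take n s).
Definition tree_code (T : seq bool -> Prop) : nset :=
  fun n => exists s : seq bool, n = pickle s /\ T s.
Definition is_path (T : seq bool -> Prop) (P : nat -> bool) : Prop :=
  forall n, T (mkseq P n).
Definition path_set (P : nat -> bool) : nset := fun n => P n = true.

(* a >> b, for degrees represented by sets D (for a) and B (for b):
   every infinite subtree of 2^{<omega} of degree b has an infinite path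
   of degree at most a. *)
Definition dom_deg (D B : nset) : Prop :=
  forall T : seq bool -> Prop, is_tree T -> infinite_set (tree_code T) ->
    Tequiv (tree_code T) B ->
    exists P : nat -> bool, is_path T P /\ Treducible (path_set P) D.

(* Main.v *)
(** A condition is a finite string [sg] approximating the join of the [A i],
together with the colors [c_0, ..., c_(s-1)] to be omitted in the first [s]
columns; the remaining columns are unrestricted.  At stage [s] the color [c_s] is
taken among two colors that column [s] of [sg] has not used yet, which is possible
because thinness omits just one of infinitely many colors.  Whether some extension
of [sg] respecting the colors makes the [s]-th computation converge is a Sigma_1
question, so 0' decides the jump; then an element is added to every column [i <= s].
The last step fails only if some chosen color is taken almost everywhere in its
column, and of two distinct colors at least one is never bad in this way.  Hence
the sequences of choices along which the construction never gets stuck are the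
paths of an infinite 0'-computable tree, and once 0' is coded into the even bits
every path computes the jump of a solution.  A degree [d >> 0'] computes such a path,
and the low basis theorem relative to 0' provides one whose jump is below 0''.

Computability of all these operations is obtained from a class of total recursive
functionals that is compiled to register machines; conversely a step-bounded
interpreter with finite oracle strings turns machines back into such functionals. *)

Require Import Defs.
From mathcomp Require Import all_boot zify boolp.
Set Implicit Arguments. Unset Strict Implicit. Unset Printing Implicit Defensive.

(** * Compilation to register machines *)

Definition chi (A : nset) (n : nat) : bool := `[< A n >].

Lemma chiP A n : reflect (A n) (chi A n).
Proof. exact: asboolP. Qed.

(** A structured language between functionals and machines. [Loop r c] tests [r] and, as long as it
    is nonzero, decrements it and runs [c], which matches the conditional decrement of the
    machine. *)
Inductive cmd := Skip | Inc of nat | Orc of nat | Seq of cmd & cmd | Loop of nat & cmd.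

Fixpoint clen c :=
  match c with
  | Skip => 0
  | Inc _ | Orc _ => 1
  | Seq c d => clen c + clen d
  | Loop _ c => (clen c).+2
  end.

(* Register 1 is kept at zero, so that (1, 1, o) is an unconditional jump. *)
Fixpoint code c o : prog :=
  match c with
  | Skip => [::]
  | Inc r => [:: (0, r, 0)]
  | Orc r => [:: (2, r, 0)]
  | Seq c d => code c o ++ code d (o + clen c)
  | Loop r c => (1, r, o + (clen c).+2) :: rcons (code c o.+1) (1, 1, o)
  end.

Lemma size_code c o : size (code c o) = clen c.
Proof.
by elim: c o => //= [c IHc d IHd|r c IHc] o; rewrite ?size_cat ?size_rcons ?IHc ?IHd.
Qed.

(** Only terminating executions are described. The premise [R2 1 = 0] of [exec_loopS] makes the
    closing instruction of a compiled loop jump back. *)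
Inductive exec (A : nset) : cmd -> regs -> regs -> Prop :=
| exec_skip R : exec A Skip R R
| exec_inc r R : exec A (Inc r) R (upd R r (R r).+1)
| exec_orc r R : exec A (Orc r) R (upd R r (chi A (R r)))
| exec_seq c d R1 R2 R3 :
    exec A c R1 R2 -> exec A d R2 R3 -> exec A (Seq c d) R1 R3
| exec_loop0 r c R : R r = 0 -> exec A (Loop r c) R R
| exec_loopS r c R1 R2 R3 k : R1 r = k.+1 -> exec A c (upd R1 r k) R2 ->
    R2 1 = 0 -> exec A (Loop r c) R2 R3 -> exec A (Loop r c) R1 R3.

Lemma runs_trans A p c1 c2 c3 :
  runs A p c1 c2 -> runs A p c2 c3 -> runs A p c1 c3.
Proof. by elim=> // c d e st _ IH /IH; apply: runs_step st. Qed.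

Lemma runs1 A p c1 c2 : step A p c1 c2 -> runs A p c1 c2.
Proof. by move=> st; apply: runs_step st (runs_refl _ _ _). Qed.

Lemma nth_code (pre q post : prog) i : i < size q ->
  nth (0, 0, 0) (pre ++ q ++ post) (size pre + i) = nth (0, 0, 0) q i /\
  size pre + i < size (pre ++ q ++ post).
Proof.
move=> iq; rewrite nth_cat ltnNge leq_addr /= addKn nth_cat iq !size_cat; split=> //.
lia.
Qed.

Lemma step_loop_enter A pre post r c R k : R r = k.+1 ->
  step A (pre ++ code (Loop r c) (size pre) ++ post)
    (size pre, R) ((size pre).+1, upd R r k).
Proof.
move=> Rr; have [] := @nth_code pre (code (Loop r c) (size pre)) post 0.
  by rewrite size_code.
by rewrite addn0 => E L; apply: step_dec Rr; [exact: L | exact: E].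
Qed.

Lemma step_loop_exit A pre post r c R : R r = 0 ->
  step A (pre ++ code (Loop r c) (size pre) ++ post)
    (size pre, R) (size pre + (clen c).+2, R).
Proof.
move=> Rr; have [] := @nth_code pre (code (Loop r c) (size pre)) post 0.
  by rewrite size_code.
by rewrite addn0 => E L; apply: step_jz Rr; [exact: L | exact: E].
Qed.

Lemma step_loop_back A pre post r c R : R 1 = 0 ->
  step A (pre ++ code (Loop r c) (size pre) ++ post)
    ((size pre).+1 + clen c, R) (size pre, R).
Proof.
move=> R1.
have [] := @nth_code pre (code (Loop r c) (size pre)) post (clen c).+1.
  by rewrite size_code.
rewrite /= nth_rcons size_code ltnn eqxx => E L; rewrite addSnnS.
by apply: step_jz R1; [exact: L | exact: E].
Qed.

(** One pass through a loop with its first step split off, so that endlessly many passes form a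
    genuinely infinite computation. *)
Lemma loop_iter A pre post r c R k R' : R r = k.+1 ->
  (forall pre post, runs A (pre ++ code c (size pre) ++ post)
     (size pre, upd R r k) (size pre + clen c, R')) ->
  R' 1 = 0 ->
  exists2 d, step A (pre ++ code (Loop r c) (size pre) ++ post) (size pre, R) d &
    runs A (pre ++ code (Loop r c) (size pre) ++ post) d (size pre, R').
Proof.
move=> Rr Hc R1; eexists; first exact: (step_loop_enter _ _ _ _ Rr).
apply: runs_trans (runs1 (step_loop_back _ _ _ _ _ R1)).
have := Hc (rcons pre (1, r, size pre + (clen c).+2)) ((1, 1, size pre) :: post).
by rewrite size_rcons cat_rcons /= cat_rcons.
Qed.

Lemma exec_runs A c R R' : exec A c R R' -> forall pre post,
  runs A (pre ++ code c (size pre) ++ post) (size pre, R) (size pre + clen c, R').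
Proof.
elim=> {c R R'}.
- by move=> R pre post; rewrite addn0; apply: runs_refl.
- move=> r R pre post; rewrite addn1; apply: runs1.
  have [] := @nth_code pre (code (Inc r) (size pre)) post 0 isT.
  by rewrite addn0 => E L; apply: step_inc L E.
- move=> r R pre post; rewrite addn1; apply: runs1.
  have [] := @nth_code pre (code (Orc r) (size pre)) post 0 isT.
  rewrite addn0 => E L; case: (chiP A (R r)) => AR.
    exact: step_orc_in L E isT AR.
  exact: step_orc_out L E isT AR.
- move=> c d R1 R2 R3 _ IHc _ IHd pre post /=.
  apply: (@runs_trans _ _ _ (size pre + clen c, R2)).
    by rewrite -catA; apply: IHc.
  have := IHd (pre ++ code c (size pre)) post.
  by rewrite size_cat size_code -!catA addnA.
- by move=> r c R Rr pre post; apply: runs1; apply: step_loop_exit.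
- move=> r c R1 R2 R3 k Rr _ IHc R21 _ IHl pre post.
  have [d st rn] := loop_iter pre post Rr IHc R21.
  by apply: runs_step st (runs_trans rn (IHl _ _)).
Qed.

(** * Total recursive functionals and their compilation *)

(** Arguments form a list, read as 0 beyond its end; larger tuples can be passed to [rec_comp] as
    codes of pairs. [rec_mu] takes the minimizing function together with a proof that the search
    always succeeds, so every member is total. *)
Inductive rec (A : nset) : (seq nat -> nat) -> Prop :=
| rec_var i : rec A (fun l => nth 0 l i)
| rec_zero : rec A (fun _ => 0)
| rec_succ F : rec A F -> rec A (fun l => (F l).+1)
| rec_comp F G H : rec A F -> rec A G -> rec A H ->
    rec A (fun l => H [:: F l; G l])
| rec_iter N G H : rec A N -> rec A G -> rec A H ->
    rec A (fun l => iteri (N l) (fun i a => H [:: a, i & l]) (G l))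
| rec_orc F : rec A F -> rec A (fun l => chi A (F l))
| rec_mu F g : rec A F ->
    (forall l, F (g l :: l) = 0 /\ forall m, m < g l -> F (m :: l) != 0) ->
    rec A g.

(* [c] computes [F] of the registers [vs] into register [b], using only zero
   registers from [b] on as scratch space and leaving them zero. *)
Definition computes A (c : cmd) (vs : seq nat) b (F : seq nat -> nat) :=
  forall R : regs, R 1 = 0 -> (forall i, b <= i -> R i = 0) ->
    exec A c R (upd R b (F [seq R i | i <- vs])).

Ltac upds := rewrite /upd; repeat (case: eqP => [?|?]); subst; try done; try lia; try congruence.

Lemma exec_add A s d R : s != d -> s != 1 -> d != 1 -> R 1 = 0 ->
  exec A (Loop s (Inc d)) R (upd (upd R d (R d + R s)) s 0).
Proof.
move=> sd s1 d1; move Ek: (R s) => k; elim: k R Ek => [|k IHk] R Ek R1.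
  rewrite addn0 (_ : upd _ _ _ = R); first exact: exec_loop0.
  by apply: funext => i; upds.
apply: exec_loopS Ek (exec_inc _ _ _) _ _; first by upds.
have := IHk (upd (upd R s k) d (upd R s k d).+1).
rewrite (_ : upd (upd (upd _ _ _) _ _) _ _ = upd (upd R d (R d + k.+1)) s 0); last first.
  by apply: funext => i; upds.
by apply; upds.
Qed.

(** A loop consumes its register, so the value goes to both [d] and [t] and is then restored from
    [t]. *)
Definition copy s d t := Seq (Loop s (Seq (Inc d) (Inc t))) (Loop t (Inc s)).

Lemma exec_copy A s d t R : uniq [:: 1; s; d; t] -> R 1 = 0 -> R d = 0 -> R t = 0 ->
  exec A (copy s d t) R (upd R d (R s)).
Proof.
rewrite /= !inE => sdt R1 Rd Rt.
have L1 k a (Q : regs) : Q 1 = 0 -> Q s = k -> Q d = a -> Q t = a ->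
  exec A (Loop s (Seq (Inc d) (Inc t))) Q (upd (upd (upd Q s 0) d (a + k)) t (a + k)).
  elim: k a Q => [|k IHk] a Q Q1 Qs Qd Qt.
    rewrite addn0 (_ : upd _ _ _ = Q); first exact: exec_loop0.
    by apply: funext => i; upds.
  apply: exec_loopS Qs (exec_seq (exec_inc _ _ _) (exec_inc _ _ _)) _ _; first by upds.
  set Q' := upd _ _ _.
  rewrite (_ : upd (upd (upd Q s 0) d (a + k.+1)) t (a + k.+1) =
    upd (upd (upd Q' s 0) d (a.+1 + k)) t (a.+1 + k)); last first.
    by apply: funext => i; rewrite /Q'; upds.
  by apply: IHk; rewrite /Q'; upds.
apply: exec_seq (L1 _ 0 _ R1 erefl Rd Rt) _.
set Q := upd _ _ _.
rewrite (_ : upd R d (R s) = upd (upd Q s (Q s + Q t)) t 0); last first.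
  by apply: funext => i; rewrite /Q; upds.
by apply: exec_add; rewrite ?/Q; upds.
Qed.

Lemma exec_clear A s R : s != 1 -> R 1 = 0 -> exec A (Loop s Skip) R (upd R s 0).
Proof.
move=> s1; move Ek: (R s) => k; elim: k R Ek => [|k IHk] R Ek R1.
  by rewrite (_ : upd _ _ _ = R); [exact: exec_loop0 | apply: funext => i; upds].
apply: exec_loopS Ek (exec_skip _ _) _ _; first by upds.
rewrite (_ : upd R s 0 = upd (upd R s k) s 0); last by apply: funext => i; upds.
by apply: IHk; upds.
Qed.

(** Register [b] counts the remaining rounds, [b.+1] holds the index, [b.+2] the accumulator, and
    [b.+3] receives each new value before it is moved down. *)
Lemma computes_iter A N G H vs b cN cG cH : 1 < b -> all (ltn^~ b) vs ->
  computes A cN vs b N -> computes A cG vs b.+2 G ->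
  computes A cH [:: b.+2, b.+1 & vs] b.+3 H ->
  computes A (Seq (Seq cN cG)
    (Seq (Loop b (Seq (Seq cH (Loop b.+2 Skip)) (Seq (Loop b.+3 (Inc b.+2)) (Inc b.+1))))
    (Seq (Loop b.+1 Skip) (Loop b.+2 (Inc b))))) vs b
    (fun l => iteri (N l) (fun i a => H [:: a, i & l]) (G l)).
Proof.
move=> b1 /allP vsb HN HG HH R R1 Rb.
have mapR (Q : regs) : (forall i, i < b -> Q i = R i) -> [seq Q i | i <- vs] = [seq R i | i <- vs].
  by move=> QR; apply/eq_in_map => i /vsb /QR.
set l := map _ _ in mapR *.
apply: exec_seq.
  apply: exec_seq (HN R R1 Rb) (HG _ _ _) => [|i]; first by upds.
  by move=> ?; upds; apply: Rb; lia.
rewrite -/l mapR; last by move=> i ?; upds.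
set h := fun i a => _; set Q0 := upd _ _ _.
(* The invariant allows any starting index and accumulator, because the loop peels off the first
   round whereas [iteri] peels off the last. *)
have L k i a : exec A (Loop b (Seq (Seq cH (Loop b.+2 Skip)) (Seq (Loop b.+3 (Inc b.+2)) (Inc b.+1))))
    (upd (upd (upd R b k) b.+1 i) b.+2 a)
    (upd (upd (upd R b 0) b.+1 (i + k)) b.+2 (iteri k (fun j => h (i + j)) a)).
  elim: k i a => [|k IHk] i a; first by rewrite addn0; apply: exec_loop0; upds.
  apply: (@exec_loopS _ _ _ _ (upd (upd (upd R b k) b.+1 i.+1) b.+2 (h i a)) _ k); try by upds.
    set Q := upd _ _ _.
    have Q1 : Q 1 = 0 by rewrite /Q; upds.
    have Qb j : b.+3 <= j -> Q j = 0 by move=> ?; rewrite /Q; upds; apply: Rb; lia.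
    have EQ : [seq Q j | j <- [:: b.+2, b.+1 & vs]] = [:: a, i & l].
      by rewrite /= mapR => [|j ?]; rewrite /Q; [congr [:: _, _ & _]; upds | upds].
    have := HH Q Q1 Qb; rewrite EQ -/(h i a) => EH.
    apply: exec_seq (exec_seq EH (exec_clear _ _ _)) (exec_seq (exec_add _ _ _ _ _) _); try by upds.
    set Q' := upd _ _ _.
    rewrite (_ : upd (upd (upd R b k) b.+1 i.+1) _ _ = upd Q' b.+1 (Q' b.+1).+1); first exact: exec_inc.
    apply: funext => j; rewrite /Q' /Q; upds; rewrite ?Rb //; lia.
  have -> : iteri k.+1 (fun j => h (i + j)) a = iteri k (fun j => h (i.+1 + j)) (h i a).
    elim: k {IHk} => [|k IHk]; first by rewrite /= addn0.
    by rewrite -[LHS]/(h (i + k.+1) (iteri k.+1 (fun j => h (i + j)) a)) IHk /= addSnnS.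
  by rewrite -addSnnS; apply: IHk.
have := L (N l) 0 (G l); rewrite (_ : upd _ _ _ = Q0); last first.
  by apply: funext => i; rewrite /Q0; upds; rewrite ?Rb.
move=> E; apply: exec_seq E (exec_seq (exec_clear _ _ _) _); try by upds.
set Q := upd _ _ _.
rewrite (_ : upd R b _ = upd (upd Q b (Q b + Q b.+2)) b.+2 0); last first.
  by apply: funext => i; rewrite /Q; upds; rewrite ?Rb; try lia; congr (iteri _ _ _); apply: funext.
by apply: exec_add; rewrite ?/Q; upds.
Qed.

(** Register [b] holds the candidate and [b.+1] the value there. Entering the loop spoils that
    value, but the body clears [b.+1] before it computes the next one. *)
Definition search cF b := Seq cF (Loop b.+1 (Seq (Seq (Loop b.+1 Skip) (Inc b)) cF)).

(* The registers when [search] is at its loop head with candidate [k]. *)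
Definition search_head (F : seq nat -> nat) vs b (R : regs) k :=
  upd (upd R b k) b.+1 (F (k :: [seq R i | i <- vs])).

Lemma search_start A F vs b cF R : 1 < b -> all (ltn^~ b) vs ->
  computes A cF (b :: vs) b.+1 F -> R 1 = 0 -> (forall i, b <= i -> R i = 0) ->
  exec A cF R (search_head F vs b R 0).
Proof.
move=> b1 /allP vsb HF R1 Rb.
have /= := HF R R1 (fun i bi => Rb i (ltnW bi)).
rewrite (Rb b) // (_ : upd R _ _ = search_head F vs b R 0) //.
by apply: funext => i; rewrite /search_head; upds; rewrite Rb.
Qed.

Lemma search_next A F vs b cF R k m : 1 < b -> all (ltn^~ b) vs ->
  computes A cF (b :: vs) b.+1 F -> R 1 = 0 -> (forall i, b <= i -> R i = 0) ->
  exec A (Seq (Seq (Loop b.+1 Skip) (Inc b)) cF) (upd (search_head F vs b R k) b.+1 m)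
    (search_head F vs b R k.+1).
Proof.
move=> b1 /allP vsb HF R1 Rb.
apply: exec_seq (exec_seq (exec_clear _ _ _) (exec_inc _ _ _)) _; try by rewrite /search_head; upds.
set Q := upd _ _ _.
have Q1 : Q 1 = 0 by rewrite /Q /search_head; upds.
have Qb i : b.+1 <= i -> Q i = 0.
  by move=> ?; rewrite /Q /search_head; upds; apply: Rb; lia.
have := HF Q Q1 Qb; congr (exec _ _ _ _).
have -> : [seq Q i | i <- b :: vs] = k.+1 :: [seq R i | i <- vs].
  rewrite /=; congr (_ :: _); first by rewrite /Q /search_head; upds.
  by apply/eq_in_map => i /vsb /= ?; rewrite /Q /search_head; upds.
by apply: funext => i; rewrite /Q /search_head; upds.
Qed.

Lemma search_found A F vs b cF R n : 1 < b -> all (ltn^~ b) vs ->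
  computes A cF (b :: vs) b.+1 F -> R 1 = 0 -> (forall i, b <= i -> R i = 0) ->
  F (n :: [seq R i | i <- vs]) = 0 ->
  (forall m, m < n -> F (m :: [seq R i | i <- vs]) != 0) ->
  exec A (search cF b) R (upd R b n).
Proof.
move=> b1 vsb HF R1 Rb; set l := map _ _ => n0 nm.
apply: exec_seq (search_start b1 vsb HF R1 Rb) _.
rewrite (_ : upd R b _ = search_head F vs b R n); last first.
  by apply: funext => i; rewrite /search_head -/l n0; upds; rewrite Rb.
(* Induction on the distance [k] from the candidate to the zero [n]. *)
have L k : k <= n -> exec A (Loop b.+1 (Seq (Seq (Loop b.+1 Skip) (Inc b)) cF))
    (search_head F vs b R (n - k)) (search_head F vs b R n).
  elim: k => [|k IHk] kn.
    by rewrite subn0; apply: exec_loop0; rewrite /search_head -/l n0; upds.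
  have {}/IHk IHk := ltnW kn.
  have lt : n - k.+1 < n by lia.
  have Hd : search_head F vs b R (n - k.+1) b.+1 = (F ((n - k.+1) :: l)).-1.+1.
    by rewrite /search_head -/l; have := nm _ lt; upds.
  apply: exec_loopS Hd (search_next _ _ b1 vsb HF R1 Rb) _ _.
    by rewrite /search_head; upds.
  by rewrite -subSn // subSS.
by have := L _ (leqnn _); rewrite subnn.
Qed.

(** Induction on the functional: intermediate values that must survive get registers above the
    target [b], and later subcomputations work from a larger base, so they cannot overwrite them. *)
Lemma rec_computes A F : rec A F -> forall vs b, 1 < b -> all (ltn^~ b) vs ->
  exists c, computes A c vs b F.
Proof.
elim=> {F}.
- move=> i vs b b1 /allP vsb; case: (ltnP i (size vs)) => iv; last first.
    exists Skip => R R1 Rb; rewrite nth_default ?size_map //.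
    rewrite (_ : upd _ _ _ = R); first exact: exec_skip.
    by apply: funext => j; upds; rewrite Rb.
  have vb : nth 0 vs i < b by apply: vsb; rewrite mem_nth.
  (* [copy] needs a source other than register 1; that register holds 0, and so does the target
     already. *)
  have [v1|v1] := eqVneq (nth 0 vs i) 1.
    exists Skip => R R1 Rb; rewrite (nth_map 0) // v1 R1.
    rewrite (_ : upd _ _ _ = R); first exact: exec_skip.
    by apply: funext => j; upds; rewrite Rb.
  exists (copy (nth 0 vs i) b b.+1) => R R1 Rb; rewrite (nth_map 0) //.
  apply: exec_copy; [by rewrite /= !inE; lia | by [] | |]; by apply: Rb; lia.
- move=> vs b b1 _; exists Skip => R R1 Rb.
  rewrite (_ : upd _ _ _ = R); first exact: exec_skip.
  by apply: funext => j; upds; rewrite Rb.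
- move=> F _ IHF vs b b1 vsb; have [c Hc] := IHF vs b b1 vsb.
  exists (Seq c (Inc b)) => R R1 Rb; apply: exec_seq (Hc R R1 Rb) _.
  set Q := upd _ _ _; rewrite (_ : upd R _ _ = upd Q b (Q b).+1); first exact: exec_inc.
  by apply: funext => j; rewrite /Q; upds.
- move=> F G H _ IHF _ IHG _ IHH vs b b1 vsb.
  have vsb' : all (ltn^~ b.+1) vs by apply: sub_all vsb => i /=; lia.
  have [cF HF] := IHF vs b.+1 (leqW b1) vsb'.
  have vsb'' : all (ltn^~ b.+2) vs by apply: sub_all vsb => i /=; lia.
  have [cG HG] := IHG vs b.+2 (leqW (leqW b1)) vsb''.
  have [|cH HH] := IHH [:: b.+1; b.+2] b.+3 (leqW (leqW (leqW b1))).
    by rewrite /=; lia.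
  exists (Seq (Seq (Seq cF cG) cH)
    (Seq (Loop b.+3 (Inc b)) (Seq (Loop b.+1 Skip) (Loop b.+2 Skip)))) => R R1 Rb.
  apply: exec_seq.
    apply: exec_seq (exec_seq (HF R R1 _) (HG _ _ _)) (HH _ _ _); try by upds.
    - by move=> i ?; apply: Rb; lia.
    - by move=> i ?; upds; apply: Rb; lia.
    - by move=> i ?; upds; apply: Rb; lia.
  set l := [seq R i | i <- vs]; set Q := upd R b.+1 _.
  have -> : [seq Q i | i <- vs] = l.
    by apply/eq_in_map => i /(allP vsb) /= ?; rewrite /Q; upds.
  set Q' := upd Q b.+2 _.
  have -> : [seq Q' i | i <- [:: b.+1; b.+2]] = [:: F l; G l].
    by rewrite /Q' /Q /=; congr [:: _; _]; upds.
  apply: exec_seq (exec_add _ _ _ _ _) (exec_seq (exec_clear _ _ _) _); try by rewrite /Q' /Q; upds.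
  set Q3 := upd _ b.+1 0.
  rewrite (_ : upd R _ _ = upd Q3 b.+2 0); last first.
    by apply: funext => i; rewrite /Q3 /Q' /Q; upds; rewrite ?Rb; lia.
  by apply: exec_clear; rewrite ?/Q3 /Q' /Q; upds.
- move=> N G H _ IHN _ IHG _ IHH vs b b1 vsb.
  have [cN HN] := IHN vs b b1 vsb.
  have [|cG HG] := IHG vs b.+2 (leqW (leqW b1)); first by apply: sub_all vsb => i /=; lia.
  have [|cH HH] := IHH [:: b.+2, b.+1 & vs] b.+3 (leqW (leqW (leqW b1))).
    by rewrite /= ltnS leqnn /=; apply/andP; split; [lia | apply: sub_all vsb => i /=; lia].
  by eexists; apply: computes_iter HN HG HH.
- move=> F _ IHF vs b b1 vsb; have [c Hc] := IHF vs b b1 vsb.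
  exists (Seq c (Orc b)) => R R1 Rb; apply: exec_seq (Hc R R1 Rb) _.
  set Q := upd _ _ _; rewrite (_ : upd R _ _ = upd Q b (chi A (Q b))); first exact: exec_orc.
  by apply: funext => j; rewrite /Q; upds.
- move=> F g _ IHF Hg vs b b1 vsb.
  have [|cF HF] := IHF (b :: vs) b.+1 (leqW b1).
    by rewrite /= ltnS leqnn; apply: sub_all vsb => i /=; lia.
  by exists (search cF b) => R R1 Rb; have [] := Hg [seq R i | i <- vs]; apply: search_found HF R1 Rb.
Qed.

Lemma rec_eval A f : rec A (fun l => f (nth 0 l 0)) -> exists p, forall x, eval A p x (f x).
Proof.
move=> /rec_computes /(_ [:: 0] 2 isT isT) [c Hc].
(* The value is computed into register 2 and then moved to the cleared register 0, where the output
   is read. *)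
pose d := Seq c (Seq (Loop 0 Skip) (Loop 2 (Inc 0))).
exists (code d 0) => x.
have Ri i : 2 <= i -> init_regs x i = 0 by case: i.
have E : exec A d (init_regs x) (upd (init_regs x) 0 (f x)).
  apply: exec_seq (Hc _ erefl Ri) (exec_seq (exec_clear _ _ _) _) => //=.
  set Q := upd _ _ _.
  rewrite (_ : upd (init_regs x) 0 (f x) = upd (upd Q 0 (Q 0 + Q 2)) 2 0).
    by apply: exec_add.
  by apply: funext => i; rewrite /Q /init_regs; upds.
have := exec_runs E [::] [::]; rewrite /= cats0 => L.
exists (0 + clen d), (upd (init_regs x) 0 (f x)); split; last by split.
by rewrite -(size_code d 0).
Qed.

Lemma step_det A p c d e : step A p c d -> step A p c e -> d = e.
Proof.
move=> st1 st2; inversion st1; subst; inversion st2; subst;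
  match goal with E : nth _ _ _ = _, E' : nth _ _ _ = _ |- _ =>
    rewrite E in E'; injection E' => *; subst end; by [congruence | ].
Qed.

Lemma step_pc A p c d : step A p c d -> c.1 < size p.
Proof. by case. Qed.

(** By determinism every run from [c] follows the infinite run through the [L k], and each
    configuration met there has a successor. *)
Lemma cycling_not_halting A p (L : nat -> config) :
  (forall k, exists2 d, step A p (L k) d & runs A p d (L k.+1)) ->
  forall k c d, runs A p c (L k) -> runs A p c d -> d.1 < size p.
Proof.
move=> HL k c d + r; elim: r k => [c' k r|c1 c2 c3 st _ IH k r].
  inversion r; subst; last by apply: step_pc; eassumption.
  by have [e /step_pc] := HL k.
inversion r; subst.
  by have [e /(step_det st) <- ?] := HL k; apply: IH; eassumption.
by apply: (IH k); rewrite (step_det st H).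
Qed.

(** The program increments its input, whence [n.+1], and then searches for a zero [k]. Its first
    instruction carries an arbitrary number [x] as data, with one [body] serving for all [x]. *)
Lemma rec_semidecided A F : rec A F -> exists body, forall x n,
  halts A ((0, 0, x) :: body) n <-> exists k, F [:: k; n.+1] = 0.
Proof.
move=> /rec_computes /(_ [:: 2; 0] 3 isT isT) [c Hc].
exists (code (search c 2) 1) => x n.
set p := _ :: _; pose pre1 : prog := [:: (0, 0, x)].
have st : step A p (0, init_regs n) (1, init_regs n.+1).
  rewrite (_ : init_regs n.+1 = upd (init_regs n) 0 (init_regs n 0).+1).
    exact: step_inc.
  by apply: funext => i; rewrite /init_regs; upds.
have R1 : init_regs n.+1 1 = 0 by [].
have Ri i : 2 <= i -> init_regs n.+1 i = 0 by case: i.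
split=> [[pc [R [pcp rn]]]|[k Fk]]; last first.
  have ex : exists k, F [:: k; n.+1] == 0 by exists k; apply/eqP.
  case: (ex_minnP ex) => m /eqP Fm Hm.
  have E : exec A (search c 2) (init_regs n.+1) (upd (init_regs n.+1) 2 m).
    apply: search_found Hc R1 Ri Fm _ => // i im.
    by apply/negP => /Hm; rewrite leqNgt im.
  have := exec_runs E pre1 [::]; rewrite cats0 => rn.
  exists (1 + clen (search c 2)), (upd (init_regs n.+1) 2 m); split.
    by rewrite /p -(size_code _ 1).
  exact: runs_step st rn.
apply: contrapT => noF.
(* Without a zero the loop head is reached with every candidate in turn, so the program cannot
   halt. *)
pose hd := search_head F [:: 0] 2 (init_regs n.+1).
have : (pc, R).1 < size p; last by rewrite /= ltnNge pcp.
apply: (@cycling_not_halting A p (fun k => (1 + clen c, hd k)) _ 0) rn => [k|]; last first.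
  apply: runs_step st _.
  have := exec_runs (@search_start A F [:: 0] 2 c _ isT isT Hc R1 Ri) pre1.
  by move=> /(_ (code (Loop 3 (Seq (Seq (Loop 3 Skip) (Inc 2)) c)) (1 + clen c))).
have Hd : hd k 3 = (F [:: k; n.+1]).-1.+1.
  by rewrite /hd /search_head /upd /=; case: (F _) (fun e => noF (ex_intro _ k e)) => // /(_ erefl).
have := @loop_iter A (pre1 ++ code c 1) [::] 3 (Seq (Seq (Loop 3 Skip) (Inc 2)) c) (hd k) _ (hd k.+1) Hd.
have -> : (pre1 ++ code c 1) ++ code (Loop 3 (Seq (Seq (Loop 3 Skip) (Inc 2)) c))
    (size (pre1 ++ code c 1)) ++ [::] = p.
  by rewrite cats0 size_cat size_code -catA.
rewrite size_cat size_code; apply=> //.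
exact: exec_runs (@search_next A F [:: 0] 2 c _ _ _ isT isT Hc R1 Ri).
Qed.

(** * Computable functions between countable types *)

Definition rec1 A (f : nat -> nat) := rec A (fun l => f (nth 0 l 0)).
Definition rec2 A (f : nat -> nat -> nat) := rec A (fun l => f (nth 0 l 0) (nth 0 l 1)).

Lemma rec_app1 A f F : rec1 A f -> rec A F -> rec A (fun l => f (F l)).
Proof. by move=> Hf HF; apply: rec_comp HF (rec_zero _) Hf. Qed.

Lemma rec_app2 A f F G : rec2 A f -> rec A F -> rec A G -> rec A (fun l => f (F l) (G l)).
Proof. by move=> Hf HF HG; apply: rec_comp HF HG Hf. Qed.

Lemma rec_ext A F G : rec A F -> F =1 G -> rec A G.
Proof. by move=> HF /funext <-. Qed.

Lemma rec_cst A c : rec A (fun _ => c).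
Proof. by elim: c => [|c IHc]; [apply: rec_zero | apply: rec_succ]. Qed.

Lemma rec_addn A : rec2 A addn.
Proof.
apply: rec_ext (rec_iter (rec_var _ 0) (rec_var _ 1) (rec_succ (rec_var _ 0))) _ => l /=.
by elim: (nth 0 l 0) => //= n ->.
Qed.

Lemma rec_predn A : rec1 A predn.
Proof.
apply: rec_ext (rec_iter (rec_var _ 0) (rec_zero _) (rec_var _ 1)) _ => l /=.
by case: (nth 0 l 0).
Qed.

Lemma rec_subn A : rec2 A subn.
Proof.
apply: rec_ext (rec_iter (rec_var _ 1) (rec_var _ 0) (rec_app1 (rec_predn A) (rec_var _ 0))) _ => l /=.
by elim: (nth 0 l 1) => [|n /= ->] /=; lia.
Qed.

Lemma rec_odd A : rec1 A (fun n => odd n).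
Proof.
apply: rec_ext (rec_iter (rec_var _ 0) (rec_zero _)
  (rec_app2 (rec_subn A) (rec_cst _ 1) (rec_var _ 0))) _ => l /=.
by elim: (nth 0 l 0) => //= n ->; case: odd.
Qed.

Lemma rec_half A : rec1 A half.
Proof.
apply: rec_ext (rec_iter (rec_var _ 0) (rec_zero _)
  (rec_app2 (rec_addn A) (rec_app1 (rec_odd A) (rec_var _ 1)) (rec_var _ 0))) _ => l /=.
by elim: (nth 0 l 0) => //= n ->; rewrite -uphalf_half.
Qed.

(** * Arithmetic of the codes of sequences and pairs *)

(** These follow the library coding of sequences of numbers, where the head is the exponent of 2 and
    the tail is read off the odd factor. Pairs are coded as sequences of length two, so [pickle] of
    a pair unfolds to [cpair]. *)
Definition ccons a m := 2 ^ a * m.*2.+1.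
Definition chead n := head 0 (CodeSeq.decode n).
Definition ctail n := CodeSeq.code (behead (CodeSeq.decode n)).
Definition cpair a b := ccons a (ccons b 0).

Lemma ccons_code a m : ccons a m = CodeSeq.code (a :: CodeSeq.decode m).
Proof. by rewrite /= CodeSeq.decodeK. Qed.

Lemma cheadK a m : chead (ccons a m) = a.
Proof. by rewrite ccons_code /chead CodeSeq.codeK. Qed.

Lemma ctailK a m : ctail (ccons a m) = m.
Proof. by rewrite ccons_code /ctail CodeSeq.codeK CodeSeq.decodeK. Qed.

Lemma ccons_surj n : 0 < n -> n = ccons (chead n) (ctail n).
Proof.
move=> n0; rewrite ccons_code /chead /ctail CodeSeq.codeK; have := CodeSeq.decodeK n.
by case: (CodeSeq.decode n) n0 => [|a s] n0 nE; first by rewrite -nE in n0.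
Qed.

Lemma iter_half_ccons a m : iter a half (ccons a m) = m.*2.+1.
Proof.
by elim: a => [|a IHa]; rewrite ?iterSr /ccons ?mul1n // expnS -mulnA mul2n doubleK.
Qed.

Lemma rec_ccons A : rec2 A ccons.
Proof.
apply: rec_ext (rec_iter (rec_var _ 0) (rec_succ (rec_app2 (rec_addn A) (rec_var _ 1) (rec_var _ 1)))
  (rec_app2 (rec_addn A) (rec_var _ 0) (rec_var _ 0))) _ => l /=.
rewrite /ccons; elim: (nth 0 l 0) => [|n /= ->]; first by rewrite mul1n addnn.
by rewrite expnS -mulnA mul2n addnn.
Qed.

Lemma rec_iter_half A : rec2 A (fun n m => iter n half m).
Proof.
apply: rec_ext (rec_iter (rec_var _ 0) (rec_var _ 1) (rec_app1 (rec_half A) (rec_var _ 0))) _ => l /=.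
by elim: (nth 0 l 0) => //= n ->.
Qed.

Lemma rec_chead A : rec1 A chead.
Proof.
(* The exponent of 2 is the least number of halvings that yields an odd number; the factor
   [0 < nth 0 l 1] stops the search at once on 0. *)
pose F l := (0 < nth 0 l 1) - odd (iter (nth 0 l 0) half (nth 0 l 1)).
apply: (@rec_mu A F).
  apply: rec_app2 (rec_subn A) _ _; last first.
    exact: rec_app1 (rec_odd A) (rec_iter_half A).
  apply: rec_ext (rec_app2 (rec_subn A) (rec_cst _ 1)
    (rec_app2 (rec_subn A) (rec_cst _ 1) (rec_var _ 1))) _ => l /=.
  by case: (nth 0 l 1).
move=> l; rewrite /F /=; have [->|n0] := posnP (nth 0 l 0); first by split.
have En := ccons_surj n0; set a := chead _ in En *; set m := ctail _ in En *.
split=> [|k ka]; rewrite {}En.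
  by rewrite iter_half_ccons /= odd_double subnn.
have -> : iter k half (ccons a m) = ccons (a - k) m.
  elim: k ka => [|k IHk] ka; first by rewrite subn0.
  rewrite iterS IHk 1?ltnW // (_ : a - k = (a - k.+1).+1); last by lia.
  by rewrite /ccons expnS -mulnA mul2n doubleK.
have -> : a - k = (a - k.+1).+1 by lia.
by rewrite /ccons expnS -mulnA mul2n odd_double.
Qed.

Lemma rec_ctail A : rec1 A ctail.
Proof.
apply: rec_ext (rec_app1 (rec_half A) (rec_app2 (rec_iter_half A) (rec_chead A) (rec_var _ 0))) _ => l /=.
have [->|n0] := posnP (nth 0 l 0); first by [].
set n := nth 0 l 0 in n0 *; rewrite {2}(ccons_surj n0) iter_half_ccons.
by rewrite -[_.+1]/(true + _) half_bit_double.
Qed.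

Lemma rec_cpair A : rec2 A cpair.
Proof.
by apply: rec_app2 (rec_ccons A) (rec_var _ 0) (rec_app2 (rec_ccons A) (rec_var _ 1) (rec_zero _)).
Qed.

(** Computability through codes; the realizer [F] is unconstrained at numbers that code no element
    of [T]. *)
Definition Comp A (T U : countType) (f : T -> U) :=
  exists2 F, rec1 A F & forall x, F (pickle x) = pickle (f x).

(** * Closure properties of computable functions *)

Section Closure.
Variable A : nset.
Implicit Types T U V W : countType.

Lemma comp_id T : Comp A (fun x : T => x).
Proof. by exists id => //; apply: rec_var. Qed.

Lemma comp_cst T U (c : U) : Comp A (fun x : T => c).
Proof. by exists (fun _ => pickle c) => //; apply: rec_cst. Qed.

Lemma comp_app T U V (g : U -> V) (f : T -> U) :
  Comp A g -> Comp A f -> Comp A (fun x => g (f x)).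
Proof.
move=> [G HG EG] [F HF EF]; exists (fun n => G (F n)) => [|x]; last by rewrite EF EG.
exact: rec_app1 HG HF.
Qed.

Lemma comp_pair T U V (f : T -> U) (g : T -> V) :
  Comp A f -> Comp A g -> Comp A (fun x => (f x, g x)).
Proof.
move=> [F HF EF] [G HG EG]; exists (fun n => cpair (F n) (G n)) => [|x].
  exact: rec_app2 (rec_cpair A) HF HG.
by rewrite EF EG.
Qed.

Lemma comp_app2 T U V W (h : U -> V -> W) (f : T -> U) (g : T -> V) :
  Comp A (fun p : U * V => h p.1 p.2) -> Comp A f -> Comp A g ->
  Comp A (fun x => h (f x) (g x)).
Proof. by move=> Hh Hf Hg; apply: comp_app Hh (comp_pair Hf Hg). Qed.

Lemma comp_fst T U V (f : T -> U * V) : Comp A f -> Comp A (fun x => (f x).1).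
Proof.
apply: comp_app; exists chead; first exact: rec_chead.
by case=> a b; rewrite -[pickle (a, b)]/(cpair (pickle a) (pickle b)) cheadK.
Qed.

Lemma comp_snd T U V (f : T -> U * V) : Comp A f -> Comp A (fun x => (f x).2).
Proof.
apply: comp_app; exists (fun n => chead (ctail n)).
  exact: rec_app1 (rec_chead A) (rec_ctail A).
by case=> a b; rewrite -[pickle (a, b)]/(cpair (pickle a) (pickle b)) ctailK cheadK.
Qed.

Lemma comp_pickle T U (f : T -> U) : Comp A f -> Comp A (fun x => pickle (f x)).
Proof. by case=> F HF EF; exists F. Qed.

Lemma comp_nat_of_bool T (f : T -> bool) : Comp A f -> Comp A (fun x => nat_of_bool (f x)).
Proof. by case=> F HF EF; exists F. Qed.

Lemma comp_succn T (f : T -> nat) : Comp A f -> Comp A (fun x => (f x).+1).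
Proof. by apply: (@comp_app T nat nat); exists succn => //; apply: rec_succ (rec_var _ 0). Qed.

Lemma comp_rec1 T (h : nat -> nat) (f : T -> nat) :
  rec1 A h -> Comp A f -> Comp A (fun x => h (f x)).
Proof. by move=> Hh; apply: (@comp_app T nat nat); exists h. Qed.

Lemma comp_rec2 T (h : nat -> nat -> nat) (f g : T -> nat) :
  rec2 A h -> Comp A f -> Comp A g -> Comp A (fun x => h (f x) (g x)).
Proof.
move=> Hh [F HF EF] [G HG EG]; exists (fun n => h (F n) (G n)) => [|x]; last by rewrite EF EG.
exact: rec_app2 Hh HF HG.
Qed.

Lemma comp_predn T (f : T -> nat) : Comp A f -> Comp A (fun x => (f x).-1).
Proof. exact: comp_rec1 (rec_predn A). Qed.

Lemma comp_half T (f : T -> nat) : Comp A f -> Comp A (fun x => (f x)./2).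
Proof. exact: comp_rec1 (rec_half A). Qed.

Lemma comp_addn T (f g : T -> nat) : Comp A f -> Comp A g -> Comp A (fun x => f x + g x).
Proof. exact: comp_rec2 (rec_addn A). Qed.

Lemma comp_subn T (f g : T -> nat) : Comp A f -> Comp A g -> Comp A (fun x => f x - g x).
Proof. exact: comp_rec2 (rec_subn A). Qed.

Lemma comp_double T (f : T -> nat) : Comp A f -> Comp A (fun x => (f x).*2).
Proof. by move=> Hf; have := comp_addn Hf Hf; under eq_fun do rewrite addnn. Qed.

Lemma comp_eq0 T (f : T -> nat) : Comp A f -> Comp A (fun x => f x == 0).
Proof.
move=> Hf; have [F HF EF] := comp_subn (comp_cst T 1) Hf.
by exists F => // x; rewrite EF; case: (f x).
Qed.

Lemma comp_leq T (f g : T -> nat) : Comp A f -> Comp A g -> Comp A (fun x => f x <= g x).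
Proof. by move=> Hf Hg; apply: comp_eq0; apply: comp_subn. Qed.

Lemma comp_eq T U (f g : T -> U) : Comp A f -> Comp A g -> Comp A (fun x => f x == g x).
Proof.
move=> /comp_pickle Hf /comp_pickle Hg.
have := comp_eq0 (comp_addn (comp_subn Hf Hg) (comp_subn Hg Hf)).
congr (Comp _ _); apply: funext => x; rewrite -(inj_eq (pcan_inj pickleK)).
by apply/eqP/eqP; lia.
Qed.

Lemma comp_if T U (b : T -> bool) (f g : T -> U) :
  Comp A b -> Comp A f -> Comp A g -> Comp A (fun x => if b x then f x else g x).
Proof.
move=> [B HB EB] [F HF EF] [G HG EG].
exists (fun n => iteri (B n) (fun _ _ => F n) (G n)) => [|x].
  by apply: (rec_iter HB HG (H := fun l => F (nth 0 l 2))); apply: rec_app1 HF (rec_var _ 2).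
by rewrite EB EF EG; case: (b x).
Qed.

Lemma comp_negb T (f : T -> bool) : Comp A f -> Comp A (fun x => ~~ f x).
Proof. by move=> Hf; apply: comp_if Hf (comp_cst _ _) (comp_cst _ _). Qed.

Lemma comp_andb T (f g : T -> bool) : Comp A f -> Comp A g -> Comp A (fun x => f x && g x).
Proof. by move=> Hf Hg; apply: comp_if Hf Hg (comp_cst _ _). Qed.

Lemma comp_implyb T (f g : T -> bool) : Comp A f -> Comp A g -> Comp A (fun x => f x ==> g x).
Proof. by move=> Hf Hg; apply: comp_if Hf Hg (comp_cst _ _). Qed.

Lemma comp_iteri T U (N : T -> nat) (z : T -> U) (h : T -> nat -> U -> U) :
  Comp A N -> Comp A (fun p : T * nat * U => h p.1.1 p.1.2 p.2) -> Comp A z ->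
  Comp A (fun x => iteri (N x) (h x) (z x)).
Proof.
move=> [FN HN EN] [FH HH EH] [FZ HZ EZ].
exists (fun n => iteri (FN n) (fun i a => FH (cpair (cpair n i) a)) (FZ n)) => [|x].
  apply: (rec_iter HN HZ (H := fun l => FH (cpair (cpair (nth 0 l 2) (nth 0 l 1)) (nth 0 l 0)))).
  apply: rec_app1 HH (rec_app2 (rec_cpair A) (rec_app2 (rec_cpair A) _ _) _); exact: rec_var.
rewrite EN EZ -[pickle (N x)]/(N x).
elim: (N x) => //= n ->; exact: (EH (x, n, _)).
Qed.

(** A nonempty sequence has a positive code, so [1 - FS n] rounds of an iteration perform the case
    distinction. *)
Lemma comp_case_seq T U V (s : T -> seq V) (h : T -> V -> seq V -> U) (g : T -> U) :
  Comp A s -> Comp A (fun p : T * V * seq V => h p.1.1 p.1.2 p.2) -> Comp A g ->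
  Comp A (fun x => if s x is y :: r then h x y r else g x).
Proof.
move=> [FS HS ES] [FH HH EH] [FG HG EG].
pose F n := FH (cpair (cpair n (chead (FS n))) (ctail (FS n))).
exists (fun n => iteri (1 - FS n) (fun _ _ => FG n) (F n)) => [|x].
  apply: (rec_iter _ _ (H := fun l => FG (nth 0 l 2))).
  - exact: rec_app2 (rec_subn A) (rec_cst _ 1) HS.
  - apply: rec_app1 HH (rec_app2 (rec_cpair A) (rec_app2 (rec_cpair A) (rec_var _ 0) _) _).
      exact: rec_app1 (rec_chead A) HS.
    exact: rec_app1 (rec_ctail A) HS.
  - exact: rec_app1 HG (rec_var _ 2).
rewrite /F ES EG; case: (s x) => [//|y r].
have -> : pickle (y :: r) = ccons (pickle y) (pickle r) by [].
rewrite cheadK ctailK; have -> : 1 - ccons (pickle y) (pickle r) = 0.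
  by apply/eqP; rewrite subn_eq0 muln_gt0 expn_gt0.
exact: (EH (x, y, r)).
Qed.

Lemma comp_cons T U (f : T -> U) (s : T -> seq U) :
  Comp A f -> Comp A s -> Comp A (fun x => f x :: s x).
Proof.
move=> [F HF EF] [G HG EG]; exists (fun n => ccons (F n) (G n)) => [|x].
  exact: rec_app2 (rec_ccons A) HF HG.
by rewrite EF EG.
Qed.

Lemma comp_behead T U (s : T -> seq U) : Comp A s -> Comp A (fun x => behead (s x)).
Proof.
move=> Hs; have := comp_case_seq (h := fun _ _ r => r) Hs (comp_snd (comp_id _)) (comp_cst _ [::]).
by congr Comp; apply: funext => x; case: (s x).
Qed.

Lemma comp_head T U (z : T -> U) (s : T -> seq U) :
  Comp A z -> Comp A s -> Comp A (fun x => head (z x) (s x)).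
Proof.
move=> Hz Hs; have := comp_case_seq (h := fun _ y _ => y) Hs (comp_snd (comp_fst (comp_id _))) Hz.
by congr Comp; apply: funext => x; case: (s x).
Qed.

Lemma comp_nth T U (z : T -> U) (s : T -> seq U) (i : T -> nat) :
  Comp A z -> Comp A s -> Comp A i -> Comp A (fun x => nth (z x) (s x) (i x)).
Proof.
move=> Hz Hs Hi.
have := comp_head Hz (comp_iteri (h := fun _ _ t => behead t) Hi (comp_behead (comp_snd (comp_id _))) Hs).
congr Comp; apply: funext => x; rewrite -nth0 -[in RHS](addn0 (i x)).
by elim: (i x) 0 => //= n IHn m; rewrite nth_behead IHn addSnnS.
Qed.

Lemma size_le_pickle U (s : seq U) : size s <= pickle s.
Proof.
elim: s => // y s IHs; rewrite -[pickle (y :: s)]/(ccons (pickle y) (pickle s)).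
rewrite /ccons -[(size _)]mul1n leq_mul ?expn_gt0 //=; lia.
Qed.

(** The iteration carries the accumulator and the rest of the list. The code of the list bounds its
    length, and rounds after the list is exhausted change nothing. *)
Lemma comp_foldl T U V (h : T -> U -> V -> U) (z : T -> U) (s : T -> seq V) :
  Comp A (fun p : T * U * V => h p.1.1 p.1.2 p.2) -> Comp A z -> Comp A s ->
  Comp A (fun x => foldl (h x) (z x) (s x)).
Proof.
move=> Hh Hz Hs.
pose k (x : T) (i : nat) (p : U * seq V) := if p.2 is y :: r then (h x p.1 y, r) else p.
have Hk : Comp A (fun q : T * nat * (U * seq V) => k q.1.1 q.1.2 q.2).
  apply: (comp_case_seq (s := fun q : T * nat * (U * seq V) => q.2.2)
    (h := fun q y r => (h q.1.1 q.2.1 y, r)) (g := fun q => q.2)).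
  - exact: comp_snd (comp_snd (comp_id _)).
  - apply: comp_pair; last exact: comp_snd (comp_id _).
    apply: (comp_app (f := fun p : T * nat * (U * seq V) * V * seq V =>
      (p.1.1.1.1, p.1.1.2.1, p.1.2)) Hh).
    apply: comp_pair (comp_pair _ _) _; first exact: comp_fst (comp_fst (comp_fst (comp_fst (comp_id _)))).
      exact: comp_fst (comp_snd (comp_fst (comp_fst (comp_id _)))).
    exact: comp_snd (comp_fst (comp_id _)).
  - exact: comp_snd (comp_id _).
have := comp_fst (comp_iteri (comp_pickle Hs) Hk (comp_pair Hz Hs)).
congr Comp; apply: funext => x.
have: forall n t a, size t <= n ->
  forall m, (iteri n (fun i => k x (m + i)) (a, t)).1 = foldl (h x) a t.
  elim=> [|n IHn] [|y t] a //= tn m.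
    suff -> : iteri n (fun i => k x (m + i)) (a, [::]) = (a, [::]) by [].
    by elim: n {IHn tn} => //= n ->.
  have -> : forall q, k x (m + n) (iteri n (fun i => k x (m + i)) q) =
    iteri n (fun i => k x (m.+1 + i)) (k x m q).
    by move=> q; elim: n {IHn tn} => //= n ->.
  exact: IHn.
by move=> /(_ _ _ (z x) (size_le_pickle (s x)) 0).
Qed.

Lemma comp_rev T U (s : T -> seq U) : Comp A s -> Comp A (fun x => rev (s x)).
Proof.
move=> Hs; have Hk : Comp A (fun p : T * seq U * U => p.2 :: p.1.2).
  exact: comp_cons (comp_snd (comp_id _)) (comp_snd (comp_fst (comp_id _))).
have := comp_foldl (h := fun _ a y => y :: a) Hk (comp_cst _ [::]) Hs.
congr Comp; apply: funext => x; rewrite /rev; elim: (s x) [::] => //=.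
Qed.

Lemma comp_foldr T U V (h : T -> V -> U -> U) (z : T -> U) (s : T -> seq V) :
  Comp A (fun p : T * V * U => h p.1.1 p.1.2 p.2) -> Comp A z -> Comp A s ->
  Comp A (fun x => foldr (h x) (z x) (s x)).
Proof.
move=> Hh Hz /comp_rev Hs.
have Hk : Comp A (fun p : T * U * V => h p.1.1 p.2 p.1.2).
  apply: (comp_app (f := fun p : T * U * V => (p.1.1, p.2, p.1.2)) Hh).
  apply: comp_pair (comp_pair _ _) _; first exact: comp_fst (comp_fst (comp_id _)).
    exact: comp_snd (comp_id _).
  exact: comp_snd (comp_fst (comp_id _)).
have := comp_foldl (h := fun x a y => h x y a) Hk Hz Hs.
by congr Comp; apply: funext => x; rewrite foldl_rev.
Qed.

End Closure.

Ltac comp_step := cbv beta; lazymatch goal with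
  | |- Comp _ (fun x => x) => apply: comp_id
  | |- Comp _ (fun x => (_, _)) => apply: comp_pair
  | |- Comp _ (fun x => fst _) => apply: comp_fst
  | |- Comp _ (fun x => snd _) => apply: comp_snd
  | |- Comp _ (fun x => nat_of_bool _) => apply: comp_nat_of_bool
  | |- Comp _ (fun x => S _) => apply: comp_succn
  | |- Comp _ (fun x => predn _) => apply: comp_predn
  | |- Comp _ (fun x => half _) => apply: comp_half
  | |- Comp _ (fun x => double _) => apply: comp_double
  | |- Comp _ (fun x => addn _ _) => apply: comp_addn
  | |- Comp _ (fun x => subn _ _) => apply: comp_subn
  | |- Comp _ (fun x => leq _ _) => apply: comp_leq
  | |- Comp _ (fun x => eq_op _ _) => apply: comp_eq
  | |- Comp _ (fun x => negb _) => apply: comp_negb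
  | |- Comp _ (fun x => andb _ _) => apply: comp_andb
  | |- Comp _ (fun x => implb _ _) => apply: comp_implyb
  | |- Comp _ (fun x => if _ then _ else _) => apply: comp_if
  | |- Comp _ (fun x => cons _ _) => apply: comp_cons
  | |- Comp _ (fun x => nth _ _ _) => apply: comp_nth
  | |- Comp _ (fun x => foldr _ _ _) => apply: comp_foldr
  | |- Comp _ (fun x => iteri _ _ _) => apply: comp_iteri
  | |- Comp _ (fun x => pickle _) => apply: comp_pickle
  | |- Comp _ (fun x => _) => fail
  | |- @Comp ?A ?T ?U ?g => change (@Comp A T U (fun x => g x))
  end.
(** A hook for the list operations, whose rules are themselves proved with [comp]. *)
Ltac comp_ext := fail.
Ltac comp := repeat (first [assumption | apply: comp_cst | comp_ext | comp_step]).

Section Lists.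
Variable A : nset.
Implicit Types T U V W : countType.

Lemma comp_map T U V (h : T -> U -> V) (s : T -> seq U) :
  Comp A (fun p : T * U => h p.1 p.2) -> Comp A s -> Comp A (fun x => [seq h x y | y <- s x]).
Proof.
move=> Hh Hs.
have -> : (fun x => [seq h x y | y <- s x]) = (fun x => foldr (fun y a => h x y :: a) [::] (s x)) by [].
comp.
apply: (comp_app2 (h := h)); comp.
Qed.

Lemma comp_cat T U (s t : T -> seq U) : Comp A s -> Comp A t -> Comp A (fun x => s x ++ t x).
Proof.
move=> Hs Ht.
have -> : (fun x => s x ++ t x) = (fun x => foldr cons (t x) (s x)).
  by apply: funext => x; elim: (s x) => //= y u ->.
comp.
Qed.

Lemma comp_size T U (s : T -> seq U) : Comp A s -> Comp A (fun x => size (s x)).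
Proof.
move=> Hs.
have -> : (fun x => size (s x)) = (fun x => foldr (fun _ n => n.+1) 0 (s x)) by [].
comp.
Qed.

Lemma comp_all T U (h : T -> U -> bool) (s : T -> seq U) :
  Comp A (fun p : T * U => h p.1 p.2) -> Comp A s -> Comp A (fun x => all (h x) (s x)).
Proof.
move=> Hh Hs.
have -> : (fun x => all (h x) (s x)) = (fun x => foldr (fun y a => h x y && a) true (s x)) by [].
comp; apply: (comp_app2 (h := h)); comp.
Qed.

Lemma comp_has T U (h : T -> U -> bool) (s : T -> seq U) :
  Comp A (fun p : T * U => h p.1 p.2) -> Comp A s -> Comp A (fun x => has (h x) (s x)).
Proof.
move=> Hh Hs.
have -> : (fun x => has (h x) (s x)) = (fun x => ~~ all (fun y => ~~ h x y) (s x)).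
  by apply: funext => x; rewrite -[has _ _]negbK -all_predC.
by apply: comp_negb; apply: comp_all => //; apply: comp_negb.
Qed.

Lemma comp_iota0 T (n : T -> nat) : Comp A n -> Comp A (fun x => iota 0 (n x)).
Proof.
move=> Hn.
have -> : (fun x => iota 0 (n x)) = (fun x => rev (iteri (n x) cons [::])).
  apply: funext => x; elim: (n x) => // k IHk.
  by rewrite -addn1 iotaD IHk add0n addn1 /= rev_cons cats1.
by apply: comp_rev; comp.
Qed.

Lemma comp_oracle T (f : T -> nat) : Comp A f -> Comp A (fun x => chi A (f x)).
Proof.
move=> [F HF EF]; exists (fun n => chi A (F n)); first exact: rec_orc HF.
by move=> x; rewrite EF.
Qed.

Lemma rec_trans B F : Comp A (chi B) -> rec B F -> rec A F.
Proof.
move=> [G HG EG]; elim=> {F}.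
- exact: rec_var.
- exact: rec_zero.
- by move=> F _; apply: rec_succ.
- by move=> F1 F2 F3 _ H1 _ H2 _ H3; apply: rec_comp.
- by move=> F1 F2 F3 _ H1 _ H2 _ H3; apply: rec_iter.
- move=> F _ HF; apply: rec_ext (rec_app1 HG HF) _ => l.
  exact: EG.
- by move=> F g _ HF Hg; apply: rec_mu HF Hg.
Qed.

Lemma comp_trans B T U (f : T -> U) : Comp A (chi B) -> Comp B f -> Comp A f.
Proof. by move=> HB [F HF EF]; exists F => //; apply: rec_trans HF. Qed.

Lemma comp_empty T U (f : T -> U) : Comp emptyset f -> Comp A f.
Proof.
apply: comp_trans; have -> : chi emptyset = fun=> false by apply: funext => n; apply/chiP.
exact: comp_cst.
Qed.

End Lists.

Ltac comp_ext ::= cbv beta; lazymatch goal with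
  | |- Comp _ (fun x => map _ _) => apply: comp_map
  | |- Comp _ (fun x => cat _ _) => apply: comp_cat
  | |- Comp _ (fun x => size _) => apply: comp_size
  | |- Comp _ (fun x => all _ _) => apply: comp_all
  | |- Comp _ (fun x => has _ _) => apply: comp_has
  | |- Comp _ (fun x => iota 0 _) => apply: comp_iota0
  | |- Comp _ (fun x => chi _ _) => apply: comp_oracle
  end.

(* Unbounded search on codes must also terminate on numbers that code no element of [T]. *)
Definition coded (T : countType) :=
  exists2 r : nat -> T, Comp emptyset r & cancel pickle r.

Lemma comp_chead A (T : countType) (f : T -> nat) : Comp A f -> Comp A (fun x => chead (f x)).
Proof. exact: comp_rec1 (rec_chead A). Qed.

Lemma comp_ctail A (T : countType) (f : T -> nat) : Comp A f -> Comp A (fun x => ctail (f x)).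
Proof. exact: comp_rec1 (rec_ctail A). Qed.

Lemma comp_decode A (T : countType) (f : T -> nat) :
  Comp A f -> Comp A (fun x => CodeSeq.decode (f x)).
Proof.
case=> F HF EF; exists F => // x; rewrite EF.
by rewrite -[RHS]/(CodeSeq.code (map id _)) map_id CodeSeq.decodeK.
Qed.

Lemma coded_nat : coded nat.
Proof. by exists id => //; apply: comp_id. Qed.

Lemma coded_bool : coded bool.
Proof. by exists (fun n => n != 0); [comp | case]. Qed.

Lemma coded_prod (T U : countType) : coded T -> coded U -> coded (T * U)%type.
Proof.
move=> [r Hr rK] [q Hq qK]; exists (fun n => (r (chead n), q (chead (ctail n)))).
  apply: comp_pair; first by apply: comp_app Hr (comp_chead (comp_id _ _)).
  by apply: comp_app Hq (comp_chead (comp_ctail (comp_id _ _))).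
case=> x y; rewrite -[pickle (x, y)]/(cpair (pickle x) (pickle y)).
by rewrite ctailK !cheadK rK qK.
Qed.

Lemma coded_seq (T : countType) : coded T -> coded (seq T).
Proof.
move=> [r Hr rK]; exists (fun n => map r (CodeSeq.decode n)).
  apply: comp_map; last exact: comp_decode (comp_id _ _).
  by apply: comp_app Hr _; comp.
by move=> s; rewrite -[pickle s]/(CodeSeq.code (map pickle s)) CodeSeq.codeK mapK.
Qed.

Lemma comp_mu A (T : countType) (b : T -> nat -> bool) (g : T -> nat) : coded T ->
  Comp A (fun p : T * nat => b p.1 p.2) ->
  (forall x, b x (g x)) -> (forall x m, b x m -> g x <= m) -> Comp A g.
Proof.
move=> [r /(comp_empty A) [R HR ER] rK] [B HB EB] bg gm.
exists (fun n => g (r n)); last by move=> x; rewrite rK.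
apply: (@rec_mu A (fun l => 1 - B (cpair (R (nth 0 l 1)) (nth 0 l 0)))).
  apply: rec_app2 (rec_subn A) (rec_cst _ _) (rec_app1 HB (rec_app2 (rec_cpair A) _ _)).
    exact: rec_app1 HR (rec_var _ 1).
  exact: rec_var.
move=> l; set n := nth 0 l 0; have E m : B (cpair (R n) m) = b (r n) m.
  by rewrite -[n]/(pickle n) ER; apply: (EB (r n, m)).
rewrite [nth _ _ _]/= -/n; split=> [|m]; rewrite [nth _ _ 0]/= E ?bg // => mg.
by case E': (b (r n) m) => //; move: (gm _ _ E'); rewrite leqNgt mg.
Qed.

(** * Sigma_1 questions and least witnesses *)

(** The jump only tells whether a program halts on its own index, so the instance [x] is written
    into the program, and the program extracts it from its input. *)
Lemma comp_sigma1_jump A (T : countType) (b : T -> nat -> bool) : coded T ->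
  Comp A (fun p : T * nat => b p.1 p.2) ->
  Comp (jump A) (fun x => `[< exists k, b x k >]).
Proof.
move=> [r /(comp_empty A) [R HR ER] rK] [B HB EB].
(* The predecessor undoes the initial increment; then the first instruction of the coded program and
   its third field are extracted. *)
pose F l := 1 - B (cpair (R (chead (ctail (chead (nth 0 l 1).-1)))) (nth 0 l 0)).
have /rec_semidecided[body Hbody] : rec A F.
  apply: rec_app2 (rec_subn A) (rec_cst _ _) (rec_app1 HB (rec_app2 (rec_cpair A) _ (rec_var _ _))).
  apply: rec_app1 HR (rec_app1 (rec_chead A) (rec_app1 (rec_ctail A) (rec_app1 (rec_chead A) _))).
  exact: rec_app1 (rec_predn A) (rec_var _ 1).
(* The third field of an increment is ignored by the machine, so it can carry [x]
   to the program, which reads it from its own code. *)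
pose n (x : T) : nat := @pickle (seq instr) ((0, 0, pickle x) :: body).
have Hn : Comp (jump A) n by rewrite /n; comp.
have := comp_oracle Hn; congr Comp; apply: funext => x.
have nE : n x = ccons (cpair (cpair 0 0) (pickle x)) (pickle body) by [].
have FE k : F [:: k; (n x).+1] = 1 - b x k.
  by rewrite /F /= nE cheadK ctailK cheadK -[pickle x]/(pickle (pickle x)) ER rK (EB (x, k)).
apply/idP/asboolP => [/chiP [p []]|[k bk]].
  rewrite pickleK => -[<-] /Hbody [k]; rewrite FE => bk.
  by exists k; case: (b x k) bk.
apply/chiP; exists ((0, 0, pickle x) :: body); split; first exact: pickleK.
by apply/Hbody; exists k; rewrite FE bk.
Qed.

Lemma comp_self_jump A : Comp (jump A) (chi A).
Proof.
have := comp_sigma1_jump (b := fun n _ => chi A n) coded_nat.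
have E : Comp A (fun p : nat * nat => chi A p.1) by comp.
move=> /(_ _ E); congr Comp; apply: funext => n.
by apply/asboolP/idP => [[]|An]; last exists 0.
Qed.

(** The least witness, or 0 if there is none; [b (wit b)] therefore tells whether a witness
    exists. *)
Definition wit (b : nat -> bool) : nat :=
  if pselect (exists m, b m) is left h then ex_minn h else 0.

Lemma witP (b : nat -> bool) m : b m -> b (wit b).
Proof. by move=> bm; rewrite /wit; case: pselect => [h|[]]; [case: ex_minnP | exists m]. Qed.

Lemma wit_le (b : nat -> bool) m : b m -> wit b <= m.
Proof.
by move=> bm; rewrite /wit; case: pselect => // h; case: ex_minnP => n _; apply.
Qed.

(** The implication guarded by existence is satisfied at 0 when no witness exists, so the search for
    its least solution is total. *)
Lemma comp_wit A (T : countType) (b : T -> nat -> bool) : coded T ->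
  Comp A (fun p : T * nat => b p.1 p.2) -> Comp (jump A) (fun x => wit (b x)).
Proof.
move=> cT Hb; have He := comp_sigma1_jump cT Hb.
apply: (comp_mu (b := fun x m => `[< exists k, b x k >] ==> b x m) cT).
- apply: comp_implyb; first by apply: comp_app He _; comp.
  exact: comp_trans (comp_self_jump A) Hb.
- by move=> x; apply/implyP => /asboolP [k /witP].
- move=> x m; rewrite /wit; case: pselect => // h; case: ex_minnP => n bn Hn /implyP bm.
  by apply: Hn; apply: bm; apply/asboolP.
Qed.

(** * A step-bounded interpreter with finite oracles *)

(** Register contents as a finite list of updates, the most recent first, so that configurations can
    be coded by numbers. *)
Definition log := seq (nat * nat).

Fixpoint lookup (g : log) (r : nat) : nat :=
  if g is (s, v) :: g' then if r == s then v else lookup g' r else 0.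

(* One step with a finite oracle [sg]; a query beyond [size sg] blocks. *)
Definition ustep (p : prog) (sg : seq bool) (c : nat * log) : nat * log :=
  if size p <= c.1 then c else
  let i := nth (0, 0, 0) p c.1 in
  let v := lookup c.2 i.1.2 in
  if i.1.1 == 0 then (c.1.+1, (i.1.2, v.+1) :: c.2)
  else if i.1.1 == 1 then
    if v == 0 then (i.2, c.2) else (c.1.+1, (i.1.2, v.-1) :: c.2)
  else if v < size sg then (c.1.+1, (i.1.2, nat_of_bool (nth false sg v)) :: c.2)
  else c.

Definition urun p sg k c := iteri k (fun _ => ustep p sg) c.
Definition uinit (x : nat) : nat * log := (0, [:: (0, x)]).
(** The length of the oracle string also bounds the number of steps, so one parameter controls
    both. *)
Definition ufinal p x sg := urun p sg (size sg) (uinit x).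
Definition uhalts p x sg := size p <= (ufinal p x sg).1.

Definition den (c : nat * log) : config := (c.1, lookup c.2).
Definition restr (A : nset) n := mkseq (chi A) n.

Lemma urunS p sg k c : urun p sg k.+1 c = urun p sg k (ustep p sg c).
Proof. by elim: k => //= k; rewrite /urun /= => ->. Qed.

Lemma urun_fix p sg k c : ustep p sg c = c -> urun p sg k c = c.
Proof. by move=> E; elim: k => //= k; rewrite /urun /= => ->. Qed.

Lemma ustep_halted p sg c : size p <= c.1 -> ustep p sg c = c.
Proof. by rewrite /ustep => ->. Qed.

Lemma urun_halted p sg k l c : size p <= (urun p sg k c).1 -> k <= l ->
  urun p sg l c = urun p sg k c.
Proof.
move=> H /subnK <-; elim: (l - k) => //= n IHn.
by rewrite /urun /= -/(urun _ _ _ _) IHn ustep_halted.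
Qed.

Lemma ustep_prefix p sg rh c :
  ustep p sg c = c \/ ustep p (sg ++ rh) c = ustep p sg c.
Proof.
rewrite /ustep; case: ifP => _; first by left.
case: ifP => _; first by right.
case: ifP => _; first by right.
case: ifP => L; last by left.
by right; rewrite size_cat ltn_addr // nth_cat L.
Qed.

(** A blocked run stays where it is and never halts. A run that halts over [sg] thus had all its
    queries answered by [sg], and a longer oracle gives the same answers. *)
Lemma urun_prefix p sg rh k c : size p <= (urun p sg k c).1 ->
  urun p (sg ++ rh) k c = urun p sg k c.
Proof.
elim: k c => // k IHk c; rewrite !urunS.
case: (ustep_prefix p sg rh c) => [E|->]; last exact: IHk.
rewrite E (urun_fix _ E) => H.
by rewrite ustep_halted // urun_fix // ustep_halted.
Qed.

Lemma ufinal_prefix p x sg rh : uhalts p x sg -> ufinal p x (sg ++ rh) = ufinal p x sg.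
Proof.
move=> H; rewrite /ufinal (@urun_halted _ _ (size sg)) ?urun_prefix //.
by rewrite size_cat leq_addr.
Qed.

Lemma uhalts_prefix p x sg rh : uhalts p x sg -> uhalts p x (sg ++ rh).
Proof. by move=> H; rewrite /uhalts ufinal_prefix. Qed.

Lemma restr_cat A m n : m <= n -> exists rh, restr A n = restr A m ++ rh.
Proof.
move=> /subnKC <-; exists (mkseq (fun i => chi A (m + i)) (n - m)).
rewrite /restr /mkseq iotaD map_cat; congr (_ ++ _).
by rewrite add0n -{1}[m]addn0 iotaDl -map_comp.
Qed.

Lemma size_restr A n : size (restr A n) = n.
Proof. exact: size_mkseq. Qed.

Lemma nth_restr A n i : i < n -> nth false (restr A n) i = chi A i.
Proof. exact: nth_mkseq. Qed.

Lemma ustep_sound A p n c : runs A p (den c) (den (ustep p (restr A n) c)).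
Proof.
case: c => pc g; rewrite /ustep; case: ifPn => [_|]; first exact: runs_refl.
rewrite -ltnNge => L.
case E: (nth _ p _) => [[t r] j]; rewrite [(pc, g).1]/= in L E *.
case: t E => [|[|t]] E; first exact/runs1/(step_inc _ _ L E).
  rewrite /=; case: eqP => V; first exact/runs1/(step_jz _ L E V).
  by apply/runs1/(step_dec _ L E); rewrite prednK // lt0n; apply/eqP.
rewrite /= size_restr; case: ifP => V; last exact: runs_refl.
apply: runs1; rewrite nth_restr //; case: chiP => AV.
  exact: step_orc_in L E isT AV.
exact: step_orc_out L E isT AV.
Qed.

Lemma urun_sound A p n k c : runs A p (den c) (den (urun p (restr A n) k c)).
Proof.
elim: k c => [|k IHk] c; first exact: runs_refl.
rewrite urunS; exact: runs_trans (ustep_sound _ _ _ _) (IHk _).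
Qed.

(** A finite run asks finitely many questions, so all sufficiently long restrictions of the oracle
    reproduce it. *)
Lemma urun_complete A p c1 c2 : runs A p c1 c2 -> forall c, den c = c1 ->
  exists k m, forall n, m <= n -> den (urun p (restr A n) k c) = c2.
Proof.
elim=> [c0 c E|{c1 c2} c1 c2 c3 st _ IH c E]; first by exists 0, 0.
suff [c' [m Hm] Ec'] : exists2 c',
    exists m, forall n, m <= n -> ustep p (restr A n) c = c' & den c' = c2.
  have [k [m' Hm']] := IH _ Ec'; exists k.+1, (maxn m m') => n.
  by rewrite geq_max urunS => /andP[/Hm -> /Hm'].
case: c E st {IH} => pc g <-; rewrite /den /ustep [(pc, g).1]/=.
move Ec: (pc, _) => c0 st.
case: st Ec => {c0 c2} [pc' R r j|pc' R r j|pc' R r j k|pc' R t r j|pc' R t r j] L E.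
- by case=> ? ?; subst; rewrite leqNgt L E /=; eexists; [exists 0 => n _ |].
- by move=> V [? ?]; subst; rewrite leqNgt L E /= V; eexists; [exists 0 => n _ |].
- by move=> V [? ?]; subst; rewrite leqNgt L E /= V; eexists; [exists 0 => n _ |].
- move=> t2 AV [? ?]; subst; rewrite leqNgt L E /=.
  case: t t2 E => [|[|t]] // _ E; exists (pc'.+1, (r, 1) :: g) => //.
  by exists (lookup g r).+1 => n V; rewrite size_restr V nth_restr // (introT (chiP _ _) AV).
- move=> t2 AV [? ?]; subst; rewrite leqNgt L E /=.
  case: t t2 E => [|[|t]] // _ E; exists (pc'.+1, (r, 0) :: g) => //.
  by exists (lookup g r).+1 => n V; rewrite size_restr V nth_restr // (introF (chiP _ _) AV).
Qed.

Lemma haltsP A p x : halts A p x <-> exists n, uhalts p x (restr A n).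
Proof.
split=> [[pc [R [pcp /urun_complete]]]|[n H]]; last first.
  exists (ufinal p x (restr A n)).1, (lookup (ufinal p x (restr A n)).2); split=> //.
  exact: (urun_sound A p n (size (restr A n)) (uinit x)).
move=> /(_ (uinit x)) []; first by rewrite /den /=; congr pair.
move=> k [m /(_ (maxn m k) (leq_maxl _ _)) E]; exists (maxn m k).
have H : size p <= (urun p (restr A (maxn m k)) k (uinit x)).1 by case: E => -> _.
by rewrite /uhalts /ufinal (urun_halted H) // size_restr leq_maxr.
Qed.

Lemma evalP A p x y n : eval A p x y -> uhalts p x (restr A n) ->
  lookup (ufinal p x (restr A n)).2 0 = y.
Proof.
case=> pc [R [pcp [/urun_complete rn Ry]]] Hn.
have [|k [m Hm]] := rn (uinit x); first by rewrite /den /=; congr pair.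
pose N := maxn n (maxn m k).
have {Hm} E : den (urun p (restr A N) k (uinit x)) = (pc, R) by apply: Hm; lia.
have [rh Erh] : exists rh, restr A N = restr A n ++ rh by apply: restr_cat; lia.
have H : size p <= (urun p (restr A N) k (uinit x)).1 by case: E => -> _.
rewrite -(ufinal_prefix rh Hn) -Erh /ufinal (urun_halted H) ?size_restr; last by lia.
by case: E => _ ->.
Qed.

Lemma eval_halts A p x y : eval A p x y -> halts A p x.
Proof. by case=> pc [R [? [? _]]]; exists pc, R. Qed.

Lemma comp_lookup A (T : countType) (g : T -> log) (r : T -> nat) :
  Comp A g -> Comp A r -> Comp A (fun x => lookup (g x) (r x)).
Proof.
move=> Hg Hr.
have -> : (fun x => lookup (g x) (r x)) =
    (fun x => foldr (fun (q : nat * nat) a => if r x == q.1 then q.2 else a) 0 (g x)).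
  by apply: funext => x; elim: (g x) => //= -[s v] l ->.
comp; by apply: comp_app Hr _; comp.
Qed.

Lemma comp_ustep A : Comp A (fun q : prog * seq bool * (nat * log) => ustep q.1.1 q.1.2 q.2).
Proof.
rewrite /ustep /=; repeat (comp; try apply: comp_lookup).
Qed.

Lemma comp_ufinal A (T : countType) (p : T -> prog) (x : T -> nat) (sg : T -> seq bool) :
  Comp A p -> Comp A x -> Comp A sg -> Comp A (fun t => ufinal (p t) (x t) (sg t)).
Proof.
move=> Hp Hx Hs; rewrite /ufinal /urun /uinit; comp.
apply: (comp_app (f := fun q : T * nat * (nat * log) => (p q.1.1, sg q.1.1, q.2)) (comp_ustep A)).
apply: comp_pair; last by comp.
by apply: comp_pair; [apply: comp_app Hp _ | apply: comp_app Hs _]; comp.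
Qed.

Lemma comp_uhalts A (T : countType) (p : T -> prog) (x : T -> nat) (sg : T -> seq bool) :
  Comp A p -> Comp A x -> Comp A sg -> Comp A (fun t => uhalts (p t) (x t) (sg t)).
Proof. by move=> Hp Hx Hs; rewrite /uhalts; comp; apply: comp_ufinal. Qed.

Lemma comp_restr A B (T : countType) (n : T -> nat) :
  Comp A (chi B) -> Comp A n -> Comp A (fun t => restr B (n t)).
Proof.
move=> HB Hn; rewrite /restr /mkseq; comp; by apply: comp_app HB _; comp.
Qed.

(** Search for a restriction of the oracle on which the interpreter halts, then read the output from
    its final configuration. *)
Lemma eval_comp A (T : countType) (f : T -> nat) p : coded T ->
  (forall x, eval A p (pickle x) (f x)) -> Comp A f.
Proof.
move=> cT Hf; have Hc : Comp A (chi A) by apply: comp_oracle; apply: comp_id.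
pose g (x : T) := wit (fun n => uhalts p (pickle x) (restr A n)).
have Hwit x : uhalts p (pickle x) (restr A (g x)).
  have /haltsP[n Hn] := eval_halts (Hf x).
  exact: (witP (b := fun n => uhalts p (pickle x) (restr A n)) Hn).
have Hg : Comp A g.
  apply: (comp_mu (b := fun x n => uhalts p (pickle x) (restr A n)) cT).
  - by apply: comp_uhalts; [comp | comp | apply: comp_restr; comp].
  - exact: Hwit.
  - by move=> x m; apply: (wit_le (b := fun n => uhalts p (pickle x) (restr A n))).
have -> : f = fun x => lookup (ufinal p (pickle x) (restr A (g x))).2 0.
  by apply: funext => x; apply/esym/evalP; [exact: Hf | exact: Hwit].
by apply: comp_lookup; comp; apply: comp_ufinal; comp; apply: comp_restr; comp.
Qed.

Lemma TreducibleP B A : Treducible B A <-> Comp A (chi B).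
Proof.
split=> [[p Hp]|[F HF EF]].
  have [] := @eval_comp A nat (fun n => chi B n) p coded_nat; last by move=> F HF EF; exists F.
  by move=> x; have [H1 H0] := Hp x; case: chiP => [/H1|/H0].
have [p Hp] := rec_eval HF; exists p => x; have := Hp x; rewrite (EF x).
by case: chiP.
Qed.

Lemma Treducible_trans A B C : Treducible A B -> Treducible B C -> Treducible A C.
Proof. by move=> /TreducibleP HA /TreducibleP HB; apply/TreducibleP; apply: comp_trans HB HA. Qed.

(** * Indices of programs and convergence *)

Definition instr_of m : instr := (chead (chead m), chead (ctail (chead m)), chead (ctail m)).

(** The decoder accepts only genuine codes. For instructions, decoding then amounts to extracting
    the components and checking that they encode back to the same number, which is computable. *)
Definition sharp (T : countType) := forall n (x : T), unpickle n = Some x -> pickle x = n.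

Lemma sharp_pair (T U : countType) : sharp T -> sharp U -> sharp (T * U)%type.
Proof.
move=> HT HU n [x y].
suff: unpickle n = Some (x, y) -> pickle (x, y) = CodeSeq.code (CodeSeq.decode n).
  by rewrite CodeSeq.decodeK.
have -> : unpickle n = if CodeSeq.decode n is [:: a; b] then
    obind (fun x => omap (pair x) (unpickle b)) (unpickle a) else None :> option (T * U).
  transitivity (pcomp (fun u => Some (pair_of_tag u)) (@unpickle {i : T & U}) n); first by [].
  rewrite /pcomp -[unpickle n]/(unpickle_tagged (fun _ : T => U) n) /unpickle_tagged.
  case: (CodeSeq.decode n) => [|a [|b []]] //=.
  by case: (unpickle a) => //= u; case: (unpickle b).
case: (CodeSeq.decode n) => [|a [|b []]] //=.
case Ea: (unpickle a) => [u|] //=; case Eb: (unpickle b) => [v|] //= [<- <-].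
by rewrite -(HT _ _ Ea) -(HU _ _ Eb).
Qed.

Lemma unpickle_instr m :
  unpickle m = if pickle (instr_of m) == m then Some (instr_of m) else None.
Proof.
case: eqP => [E|ne]; first by rewrite -[in LHS]E pickleK.
case E: (unpickle m) => [i|] //; case: ne.
have sharp_nat : sharp nat by move=> n x [].
have <- : pickle i = m by apply: (sharp_pair (sharp_pair sharp_nat sharp_nat) sharp_nat).
case: i {E} => [[t r] j].
rewrite -[pickle (t, r, j)]/(cpair (cpair t r) j) /instr_of.
by rewrite !(ctailK, cheadK).
Qed.

(** This is [unpickle] at type [prog], which skips entries that code no instruction and never fails:
    every number is the index of a program. *)
Definition prog_of n : prog := pmap unpickle (CodeSeq.decode n).

Lemma comp_prog_of A (T : countType) (f : T -> nat) : Comp A f -> Comp A (fun x => prog_of (f x)).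
Proof.
move=> Hf.
have -> : (fun x => prog_of (f x)) = (fun x => foldr (fun m a =>
    if pickle (instr_of m) == m then instr_of m :: a else a) [::] (CodeSeq.decode (f x))).
  apply: funext => x; rewrite /prog_of; elim: (CodeSeq.decode _) => //= m s <-.
  by rewrite unpickle_instr; case: ifP.
rewrite /instr_of; repeat (comp; try (first [apply: comp_decode | apply: comp_chead | apply: comp_ctail])).
Qed.

Definition converges e sg := uhalts (prog_of e) e sg.

Lemma jumpP A e : jump A e <-> exists n, converges e (restr A n).
Proof.
rewrite -haltsP; split=> [[p [[<-]]]|H] //.
by exists (prog_of e).
Qed.

Lemma converges_prefix e sg rh : converges e sg -> converges e (sg ++ rh).
Proof. exact: uhalts_prefix. Qed.

Lemma comp_converges A (T : countType) (e : T -> nat) (sg : T -> seq bool) :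
  Comp A e -> Comp A sg -> Comp A (fun t => converges (e t) (sg t)).
Proof. by move=> He Hs; apply: comp_uhalts => //; apply: comp_prog_of. Qed.

(** Convergence over some restriction of [A] is a Sigma_1 question relative to [B]. *)
Lemma jump_mono A B : Treducible A B -> Treducible (jump A) (jump B).
Proof.
move=> /TreducibleP HA; apply/TreducibleP.
have := comp_sigma1_jump (b := fun e n => converges e (restr A n)) coded_nat.
have E : Comp B (fun p : nat * nat => converges p.1 (restr A p.2)).
  by apply: comp_converges; [comp | apply: comp_restr; comp].
move=> /(_ _ E); congr Comp; apply: funext => e.
by apply/asboolP/chiP => /jumpP.
Qed.

(** * The low basis theorem *)

(** A single path through all members of a decreasing sequence of infinite trees, by compactness. *)
Lemma konig (S : nat -> seq bool -> Prop) :
  (forall e s n, S e s -> S e (take n s)) -> (forall e s, S e.+1 s -> S e s) ->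
  (forall e n, exists2 s, size s = n & S e s) ->
  exists P, forall e n, S e (mkseq P n).
Proof.
move=> Stake Sdec Slev.
have Smono e e' s : e <= e' -> S e' s -> S e s.
  by move=> /subnK <-; elim: (e' - e) => //= d IHd /Sdec.
(* The invariant: [s] has extensions of every length in every one of the trees. *)
pose ext s := forall e n, exists2 t, size t = n & S e (s ++ t).
have extS s : ext s -> ext (rcons s true) \/ ext (rcons s false).
  move=> es; apply: contrapT.
  move=> /not_orP[/existsNP[e1 /existsNP[n1 H1]] /existsNP[e0 /existsNP[n0 H0]]].
  (* If both one-bit extensions fail, a longer string taken from the later of the two trees refutes
     the failure on the side of its first bit. *)
  have [[|b t] // [tn] St] := es (maxn e1 e0) (maxn n1 n0).+1.
  have Stk e m : e <= maxn e1 e0 -> m <= maxn n1 n0 ->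
      exists2 u, size u = m & S e (rcons s b ++ u).
    move=> le lm; exists (take m t); first by rewrite size_take tn; case: ltngtP lm.
    apply: Smono le _; move: (Stake _ _ (size s + m.+1) St).
    by rewrite take_cat ltnNge leq_addr addKn /= cat_rcons.
  by case: b St Stk => _ Stk; [apply: H1 | apply: H0]; apply: Stk; lia.
pose bit s := `[< ext (rcons s true) >].
pose pre := fix pre n := if n is m.+1 then rcons (pre m) (bit (pre m)) else [::].
exists (fun n => bit (pre n)) => e n.
have -> : mkseq (fun n => bit (pre n)) n = pre n.
  by elim: n => //= n IHn; rewrite mkseqS IHn.
suff /(_ e 0) [t /size0nil ->] : ext (pre n) by rewrite cats0.
elim: n => [|n IHn] /=; first exact: Slev.
by rewrite /bit; case: asboolP => // ne; case: (extS _ IHn).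
Qed.

Definition bitstrings n : seq (seq bool) :=
  iteri n (fun _ L => [seq true :: s | s <- L] ++ [seq false :: s | s <- L]) [:: [::]].

Lemma mem_bitstrings n s : (s \in bitstrings n) = (size s == n).
Proof.
elim: n s => [|n IHn] s; first by rewrite inE; case: s.
rewrite /bitstrings /= -/(bitstrings n) mem_cat; apply/orP/eqP => [[] /mapP[t]|].
- by rewrite IHn => /eqP <- ->.
- by rewrite IHn => /eqP <- ->.
- by case: s => // -[] s [/eqP]; rewrite -IHn => ?; [left | right]; apply: map_f.
Qed.

Lemma comp_bitstrings A (T : countType) (n : T -> nat) :
  Comp A n -> Comp A (fun x => bitstrings (n x)).
Proof. by move=> Hn; rewrite /bitstrings; comp. Qed.

Lemma infinite_tree_level (T : seq bool -> Prop) : is_tree T -> infinite_set (tree_code T) ->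
  forall n, exists2 s, size s = n & T s.
Proof.
move=> Ttree Tinf n.
(* [N] bounds the codes of all strings shorter than [n], so a string of the tree with a larger code
   has length at least [n]. *)
pose N := \max_(m < n) \max_(s <- bitstrings m) pickle s.
have [m [le [s [mE Ts]]]] := Tinf N.+1; rewrite {m}mE in le.
exists (take n s); last exact: Ttree.
rewrite size_take; case: ltnP => // sn; apply/eqP; rewrite eqn_leq sn /= leqNgt; apply/negP => lt.
have : pickle s <= N; last by rewrite leqNgt le.
apply: leq_trans (leq_bigmax (Ordinal lt)) => /=.
by apply: (leq_bigmax_seq (F := pickle)) => //; rewrite mem_bitstrings.
Qed.

Section LowBasis.
Variable T : seq bool -> Prop.
Hypotheses (Ttree : is_tree T) (Tinf : infinite_set (tree_code T)).

(** The strings of the tree along which no computation in [E] has converged yet. *)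
Definition subtree E s := chi (tree_code T) (pickle s) && all (fun e => ~~ converges e s) E.

Definition dies E n := all (fun s => ~~ subtree E s) (bitstrings n).

(* The computations below [n] that diverge along every path of the final tree. *)
Fixpoint forced n : seq nat :=
  if n is e.+1 then
    if `[< exists n, dies (e :: forced e) n >] then forced e else e :: forced e
  else [::].

Lemma chi_tree_code s : chi (tree_code T) (pickle s) = `[< T s >].
Proof.
apply/chiP/asboolP => [[t [/(pcan_inj pickleK) -> //]]|Ts]; by exists s.
Qed.

Lemma subtree_take E s n : subtree E s -> subtree E (take n s).
Proof.
rewrite /subtree !chi_tree_code => /andP[/asboolP Ts /allP HE].
rewrite (asboolT (Ttree n Ts)); apply/allP => e /HE; apply: contra.
by rewrite -{2}(cat_take_drop n s) => /converges_prefix; apply.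
Qed.

Lemma subtree_forced e s : subtree (forced e.+1) s -> subtree (forced e) s.
Proof.
by rewrite /=; case: ifP => // _; rewrite /subtree /= => /and3P[-> _ ->].
Qed.

Lemma forced_alive e n : ~~ dies (forced e) n.
Proof.
elim: e n => [|e IHe] n /=.
  have [s sn Ts] := infinite_tree_level Ttree Tinf n.
  apply/allPn; exists s; first by rewrite mem_bitstrings sn.
  by rewrite negbK /subtree chi_tree_code asboolT.
by case: asboolP => // H; apply/negP => D; apply: H; exists n.
Qed.

Lemma comp_subtree (U : countType) A (E : U -> seq nat) (s : U -> seq bool) :
  Comp A (chi (tree_code T)) -> Comp A E -> Comp A s ->
  Comp A (fun x => subtree (E x) (s x)).
Proof.
move=> HT HE Hs; rewrite /subtree; comp.
  by apply: comp_app HT _; comp.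
by apply: comp_converges; comp; apply: comp_app Hs _; comp.
Qed.

Lemma comp_dies_ex :
  Comp (jump (tree_code T)) (fun E => `[< exists n, dies E n >]).
Proof.
apply: comp_sigma1_jump; first exact: coded_seq coded_nat.
have HT : Comp (tree_code T) (chi (tree_code T)) by apply: comp_oracle; comp.
rewrite /dies; comp; last by apply: comp_bitstrings; comp.
by apply: comp_subtree; comp.
Qed.

(** The jump of the tree decides whether forcing [e] to diverge kills the current subtree. If so,
    [e] converges along every path of that subtree; if not, divergence is forced. The same answers
    therefore decide the jump of the path. *)
Lemma low_basis :
  exists2 P, is_path T P & Treducible (jump (path_set P)) (jump (tree_code T)).
Proof.
have [] := @konig (fun e s => subtree (forced e) s).
- by move=> e s n; apply: subtree_take.
- exact: subtree_forced.
- move=> e n; have /allPn[s] := forced_alive e n.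
  by rewrite mem_bitstrings negbK => /eqP; exists s.
move=> P HP; exists P => [n|].
  by have := HP 0 n; rewrite /subtree chi_tree_code => /andP[/asboolP].
have restrP n : restr (path_set P) n = mkseq P n.
  by apply: eq_map => i; apply/chiP/idP.
apply/TreducibleP.
have Hf : Comp (jump (tree_code T)) forced.
  have -> : forced = fun n => iteri n (fun e E =>
      if `[< exists n, dies (e :: E) n >] then E else e :: E) [::].
    by apply: funext; elim=> //= n ->.
  by comp; apply: comp_app comp_dies_ex _; comp.
have -> : chi (jump (path_set P)) = fun e => `[< exists n, dies (e :: forced e) n >].
  apply: funext => e; apply/chiP/asboolP => [/jumpP[n]|[n D]].
    rewrite restrP => He; apply: contrapT => D.
    have := HP e.+1 n; rewrite /= asboolF // /subtree /= => /and3P[_ /negP].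
    by move=> /(_ He).
  apply/jumpP; exists n; rewrite restrP; move: (HP e n).
  have /allP/(_ (mkseq P n)) := D; rewrite mem_bitstrings size_mkseq eqxx /subtree /= => /(_ isT).
  by case: converges => //= /negP.
by apply: comp_app comp_dies_ex _; comp.
Qed.

End LowBasis.

(** * The construction *)

Definition unp n : nat * nat := (chead n, chead (ctail n)).

Lemma unpK i x : unp (npair i x) = (i, x).
Proof. by rewrite -[npair i x]/(cpair i x) /unp cheadK ctailK cheadK. Qed.

Lemma npair_ltr i x y : npair i x < npair i y -> x < y.
Proof.
rewrite !ltnNge; apply: contra => yx; rewrite -![npair _ _]/(cpair _ _) /cpair /ccons.
by rewrite leq_mul // ltnS leq_double leq_mul // leq_exp2l.
Qed.

Definition dec m : seq bool := [seq n != 0 | n <- CodeSeq.decode m].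

Lemma decK : cancel pickle dec.
Proof.
move=> s; rewrite -[pickle s]/(CodeSeq.code (map pickle s)) /dec CodeSeq.codeK mapK //.
by case.
Qed.

Lemma comp_dec A (T : countType) (m : T -> nat) : Comp A m -> Comp A (fun x => dec (m x)).
Proof. by move=> Hm; rewrite /dec; comp; apply: comp_decode. Qed.

Lemma nth_lt_size (t : seq bool) n : nth false t n -> n < size t.
Proof. by case: ltnP => // /(nth_default false) ->. Qed.

Section Construction.
Variable f : nat -> nat -> nat.

Definition fval n := f (unp n).1 (unp n).2.

(* [nth 0 cs i] is the color that column [i < size cs] must omit. *)
Definition allowed (cs : seq nat) n :=
  (npair (unp n).1 (unp n).2 == n) &&
  (((unp n).1 < size cs) ==> (fval n != nth 0 cs (unp n).1)).

Definition good cs (t : seq bool) :=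
  all (fun n => nth false t n ==> allowed cs n) (iota 0 (size t)).

Definition grows k m (t : seq bool) :=
  all (fun i => has (fun n => nth false t n && ((m <= n) && ((unp n).1 == i)))
    (iota 0 (size t))) (iota 0 k).

(** One plus the sum of all values of [f] at positions of [sg]: this number and its successor both
    exceed every color used so far. *)
Definition fresh (sg : seq bool) := foldr (fun n a => fval n + a) 1 (iota 0 (size sg)).

Definition forcing_ext s sg cs m := good cs (sg ++ dec m) && converges s (sg ++ dec m).
Definition growing_ext sg cs m :=
  good cs (sg ++ dec m) && grows (size cs) (size sg) (sg ++ dec m).

Definition extend (b : nat -> bool) (sg : seq bool) :=
  if b (wit b) then sg ++ dec (wit b) else sg.

(** A flag telling that no stage has been stuck, the current string, and the colors chosen so
    far. *)
Definition state : Type := (bool * seq bool * seq nat)%type.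
Definition newcs (bit : bool) (st : state) := st.2 ++ [:: fresh st.1.2 + bit].
Definition mid s bit (st : state) := extend (forcing_ext s st.1.2 (newcs bit st)) st.1.2.
Definition forces s bit (st : state) :=
  let b := forcing_ext s st.1.2 (newcs bit st) in b (wit b).
Definition stage s bit (st : state) : state :=
  let b := growing_ext (mid s bit st) (newcs bit st) in
  (st.1.1 && b (wit b), extend b (mid s bit st), newcs bit st).

(** Only the odd bits of [P] steer the construction; the even ones are reserved for coding. *)
Definition run (P : nat -> bool) s : state :=
  iteri s (fun i st => stage i (P i.*2.+1) st) (true, [::], [::]).

Lemma goodP cs t :
  reflect (forall n, nth false t n -> allowed cs n) (good cs t).
Proof.
apply: (iffP allP) => [H n tn|H n _]; last by apply/implyP/H.
by apply: (implyP (H n _) tn); rewrite mem_iota /= nth_lt_size.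
Qed.

Lemma growsP k m t i : grows k m t -> i < k ->
  exists n, [/\ nth false t n, m <= n & (unp n).1 = i].
Proof.
move=> /allP/(_ i); rewrite mem_iota /= add0n => + ik => /(_ ik) /hasP[n _].
by case/and3P => tn mn /eqP ni; exists n.
Qed.

Lemma fresh_gt sg n : n < size sg -> fval n < fresh sg.
Proof.
rewrite /fresh; have: 0 < 1 by [].
move=> H L; have : n \in iota 0 (size sg) by rewrite mem_iota.
elim: (iota _ _) => //= m s IHs; rewrite inE => /orP[/eqP ->|/IHs]; last by lia.
suff : 0 < foldr (fun n a => fval n + a) 1 s by lia.
by elim: s {IHs} => //= ? ? ?; lia.
Qed.

Lemma allowed_cat cs ds n : allowed (cs ++ ds) n -> allowed cs n.
Proof.
rewrite /allowed size_cat => /andP[-> /= /implyP H]; apply/implyP => L.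
by move: (H (ltn_addr _ L)); rewrite nth_cat L.
Qed.

(** Either candidate for the new color exceeds all values on the current string, hence no element
    already present violates it. *)
Lemma good_newcs bit (st : state) : good st.2 st.1.2 -> good (newcs bit st) st.1.2.
Proof.
move=> /goodP H; apply/goodP => n sn; have := H n sn.
have L := fresh_gt (nth_lt_size sn).
rewrite /allowed size_cat addn1 nth_cat => /andP[-> /= /implyP Hi].
apply/implyP; rewrite ltnS leq_eqVlt; case: ltnP => [/Hi //|le].
rewrite orbF => /eqP ->; rewrite subnn /=; lia.
Qed.

Lemma good_stage s bit (st : state) :
  good st.2 st.1.2 -> good (stage s bit st).2 (stage s bit st).1.2.
Proof.
move=> /(good_newcs bit) H; rewrite /stage /= /extend; case: ifP => [/andP[] //|_].
by rewrite /mid /extend; case: ifP => [/andP[] |].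
Qed.

Lemma good_run P s : good (run P s).2 (run P s).1.2.
Proof. by elim: s => // s IHs; apply: good_stage. Qed.

Lemma size_run P s : size (run P s).2 = s.
Proof.
by elim: s => // s IHs; rewrite -[run P s.+1]/(stage _ _ _) /= size_cat IHs addn1.
Qed.

Lemma extend_prefix b sg : exists rh, extend b sg = sg ++ rh.
Proof. by rewrite /extend; case: ifP; [eexists | exists [::]; rewrite cats0]. Qed.

Lemma run_prefix P s t : s <= t ->
  (exists rh, (run P t).1.2 = (run P s).1.2 ++ rh) /\
  (exists ds, (run P t).2 = (run P s).2 ++ ds).
Proof.
move=> /subnK <-; elim: (t - s) => [|n [[rh IH1] [ds IH2]]].
  by split; exists [::]; rewrite cats0.
rewrite addSn -[run P (n + s).+1]/(stage _ _ _) /=; split; last first.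
  by rewrite /newcs IH2 -catA; eexists.
have [r1 ->] := extend_prefix (growing_ext (mid (n + s) (P (n + s).*2.+1) (run P (n + s)))
  (newcs (P (n + s).*2.+1) (run P (n + s)))) (mid (n + s) (P (n + s).*2.+1) (run P (n + s))).
rewrite /mid; have [r2 ->] := extend_prefix (forcing_ext (n + s) (run P (n + s)).1.2
  (newcs (P (n + s).*2.+1) (run P (n + s)))) (run P (n + s)).1.2.
by rewrite IH1 -!catA; eexists.
Qed.

(** * The solution defined by a path *)

Section Path.
Variable P : nat -> bool.
Hypothesis Pok : forall s, (run P s).1.1.

Let sg s := (run P s).1.2.
Let cs s := (run P s).2.

Definition solution i : nset := fun x => exists s, nth false (run P s).1.2 (npair i x).

Lemma run_grows s i : i <= s ->
  exists n, [/\ nth false (sg s.+1) n, size (sg s) <= n & (unp n).1 = i].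
Proof.
move=> le; have := Pok s.+1; rewrite -[run P s.+1]/(stage _ _ _) /=.
set b := growing_ext _ _ => /andP[_ H].
have [n [tn mn ni]] : exists n, [/\ nth false (sg s.+1) n,
    size (mid s (P s.*2.+1) (run P s)) <= n & (unp n).1 = i].
  rewrite /sg -[run P s.+1]/(stage _ _ _) /= -/b /extend H; case/andP: H => _ H.
  by apply: growsP H _; rewrite size_cat size_run addn1.
exists n; split=> //; apply: leq_trans mn; rewrite /mid.
have [rh ->] := extend_prefix (forcing_ext s (run P s).1.2
  (newcs (P s.*2.+1) (run P s))) (run P s).1.2.
by rewrite size_cat leq_addr.
Qed.

Lemma size_sg s : s <= size (sg s).
Proof.
elim: s => // s IHs; have [n [/nth_lt_size ns sn _]] := run_grows (leq0n s).
by apply: leq_ltn_trans IHs (leq_ltn_trans sn ns).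
Qed.

Lemma sg_le s t n : s <= t -> n < size (sg s) -> nth false (sg t) n = nth false (sg s) n.
Proof. by move=> /(run_prefix P) [[rh E] _] L; rewrite /sg E nth_cat L. Qed.

(** Later strings extend earlier ones, and goodness ensures that every position holding [true] is
    the code of a pair. *)
Lemma seq_code_sg s n : n < size (sg s) ->
  chi (seq_code solution) n = nth false (sg s) n.
Proof.
move=> L; apply/chiP/idP => [[i [x [nE [t Ht]]]]|H].
  rewrite -nE in Ht; case: (leqP s t) => [le|/ltnW le]; first by rewrite -(sg_le le).
  by rewrite (sg_le le) //; apply: nth_lt_size.
have /goodP/(_ n H)/andP[/eqP E _] := good_run P s.
by exists (unp n).1, (unp n).2; rewrite E; split=> //; exists s; rewrite E.
Qed.

Lemma restr_sg s : restr (seq_code solution) (size (sg s)) = sg s.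
Proof.
apply: (@eq_from_nth _ false); first by rewrite size_restr.
by move=> i; rewrite size_restr => L; rewrite nth_restr // (seq_code_sg L).
Qed.

Lemma solution_infinite i : infinite_set (solution i).
Proof.
(* At this stage the string is longer than [npair i m], so the element added to column [i] lies
   beyond [m]. *)
move=> m; have [|n [ns sn ni]] := @run_grows (i + (npair i m).+1) i; first by lia.
have /goodP/(_ n ns)/andP[/eqP E _] := good_run P (i + (npair i m).+1).+1.
have {}E : npair i (unp n).2 = n by rewrite -{1}ni E.
exists (unp n).2; split; last by exists (i + (npair i m).+1).+1; rewrite E.
apply/ltnW/(@npair_ltr i); rewrite E; apply: leq_trans sn.
by apply: leq_trans (size_sg _); lia.
Qed.

(** The color of column [i] is fixed at stage [i], and all later strings respect it. *)
Lemma solution_thin i : thin_for (solution i) (f i).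
Proof.
exists (nth 0 (cs i.+1) i) => x [s]; rewrite -/(sg s) => Hs.
have [[rh E1] _] := @run_prefix P s (maxn s i.+1) (leq_maxl _ _).
have [_ [ds E2]] := @run_prefix P i.+1 (maxn s i.+1) (leq_maxr _ _).
have H : nth false (sg (maxn s i.+1)) (npair i x).
  by rewrite /sg E1 nth_cat nth_lt_size.
have /goodP/(_ _ H)/andP[_] := good_run P (maxn s i.+1).
rewrite /fval unpK /= size_run leq_maxr /= E2 nth_cat size_run ltnSn.
by move/eqP.
Qed.

(** If [e] converges on the solution, a later string already shows this; it respects all later
    colors and so is a forcing extension at stage [e]. Conversely [mid] appends such an extension
    whenever one exists. *)
Lemma jump_solution e :
  chi (jump (seq_code solution)) e = forces e (P e.*2.+1) (run P e).
Proof.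
set b := forcing_ext e (run P e).1.2 (newcs (P e.*2.+1) (run P e)).
apply/chiP/idP => [/jumpP[n He]|H].
  pose s := maxn n e.+1.
  have {}He : converges e (sg s).
    have [|rh E] := @restr_cat (seq_code solution) n (size (sg s)).
      by apply: leq_trans (size_sg _); apply: leq_maxl.
    by rewrite -restr_sg E; apply: converges_prefix.
  have [[rh E1] _] := @run_prefix P e s (ltnW (leq_maxr _ _)).
  have [_ [ds E2]] := @run_prefix P e.+1 s (leq_maxr _ _).
  apply: (@witP b (pickle rh)); rewrite /b /forcing_ext decK -E1 He andbT.
  apply/goodP => m Hm; apply: (@allowed_cat _ ds).
  have -> : newcs (P e.*2.+1) (run P e) ++ ds = cs s by rewrite /cs E2.
  by have /goodP := good_run P s; apply.
apply/jumpP; exists (size (sg e.+1)); rewrite restr_sg /sg -[run P e.+1]/(stage _ _ _) /=.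
set c := growing_ext _ _; have [rh ->] := extend_prefix c (mid e (P e.*2.+1) (run P e)).
apply: converges_prefix; rewrite /mid /extend -/b; move: H; rewrite /forces -/b => H.
by rewrite H; case/andP: H.
Qed.

End Path.

(* The even bits force every path to compute 0'; the odd bits choose the colors. *)
Definition choice_tree (b : seq bool) :=
  all (fun i => nth false b i.*2 == chi (jump emptyset) i) (iota 0 (uphalf (size b))) &&
  (run (nth false b) (size b)./2).1.1.

Lemma run_ext P Q s : (forall i, i < s -> P i.*2.+1 = Q i.*2.+1) -> run P s = run Q s.
Proof.
elim: s => // s IHs H; rewrite -[run P _]/(stage s (P s.*2.+1) (run P s)) H // IHs //.
by move=> i Hi; apply: H; apply: leqW.
Qed.

Lemma run_ok_le P s t : s <= t -> (run P t).1.1 -> (run P s).1.1.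
Proof.
by move=> /subnK <-; elim: (t - s) => // n IHn /andP[/IHn].
Qed.

Lemma choice_tree_take b n : choice_tree b -> choice_tree (take n b).
Proof.
case: (ltnP n (size b)) => [L|L]; last by rewrite take_oversize.
case/andP => /allP H1 H2; apply/andP; rewrite size_takel ?(ltnW L) //; split.
  apply/allP => i; rewrite mem_iota add0n /= => Hi; have Hi' : i.*2 < n by lia.
  by rewrite nth_take //; apply: H1; rewrite mem_iota /=; lia.
rewrite (@run_ext _ (nth false b)) => [|i Hi]; last by rewrite nth_take //; lia.
by apply: run_ok_le H2; lia.
Qed.

Lemma choice_tree_path P : (forall n, choice_tree (mkseq P n)) ->
  (forall s, (run P s).1.1) /\ (forall i, P i.*2 = chi (jump emptyset) i).
Proof.
move=> H; split=> [s|i].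
  have /andP[_] := H s.*2; rewrite size_mkseq doubleK.
  by rewrite (@run_ext _ P) // => i Hi; rewrite nth_mkseq //; lia.
have /andP[/allP/(_ i) + _] := H i.*2.+1; rewrite mem_iota size_mkseq /= nth_mkseq //.
by move=> HH; apply/eqP/HH; lia.
Qed.

Lemma choice_tree_of_path P :
  (forall s, (run P s).1.1) -> (forall i, P i.*2 = chi (jump emptyset) i) ->
  forall n, choice_tree (mkseq P n).
Proof.
move=> H1 H2 n; apply/andP; rewrite size_mkseq; split.
  by apply/allP => i; rewrite mem_iota /= => Hi; rewrite nth_mkseq ?H2 //; lia.
by rewrite (@run_ext _ P) // => i Hi; rewrite nth_mkseq //; lia.
Qed.

(** The second candidate is taken exactly when the first one is the value at almost all points of
    the column; the second is then avoided almost everywhere. The choice is classical and serves to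
    exhibit a path. *)
Definition choice_bit s (st : state) : bool :=
  `[< ~ infinite_set (fun x => f s x <> fresh st.1.2) >].

Lemma choice_bitP s st : infinite_set (fun x => f s x <> fresh st.1.2 + choice_bit s st).
Proof.
rewrite /choice_bit; case: asboolP => [/existsNP[n Hn] m|/contrapT]; last by rewrite addn0.
exists (maxn m n); split; first exact: leq_maxl.
move=> E; apply: Hn; exists (maxn m n); split; first exact: leq_maxr.
by rewrite E; lia.
Qed.

Lemma growing_ext_ex sg cs : good cs sg ->
  (forall i, i < size cs -> infinite_set (fun x => f i x <> nth 0 cs i)) ->
  exists m, growing_ext sg cs m.
Proof.
move=> /goodP gs Hinf.
(* A bound [N] below which each of the first [k] columns has an allowed new element, obtained column
   by column. *)
have L k : k <= size cs -> exists N, forall i, i < k -> exists n,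
    [/\ size sg <= n, n < N, allowed cs n & (unp n).1 = i].
  elim: k => [|k IHk] kc; first by exists 0.
  have [N HN] := IHk (ltnW kc); have [x [Lx fx]] := Hinf k kc (size sg).
  exists (maxn N (npair k x).+1) => i; rewrite ltnS leq_eqVlt => /orP[/eqP ->|/HN].
    exists (npair k x); rewrite unpK; split.
    - apply: leq_trans Lx _; rewrite -[npair _ _]/(cpair _ _) /cpair /ccons.
      have : x < 2 ^ x by apply: ltn_expl.
      have : 0 < 2 ^ k by rewrite expn_gt0.
      by rewrite double0 muln1 -mul2n; move: (2 ^ x) (2 ^ k) => a b; nia.
    - by rewrite leq_maxr.
    - by rewrite /allowed /fval unpK eqxx /= kc /=; apply/eqP.
    - by [].
  by case=> n [? Ln ? ?]; exists n; split=> //; apply: leq_trans Ln (leq_maxl _ _).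
have [N HN] := L _ (leqnn _).
(* The extension up to [N] contains every allowed position. *)
pose rh := mkseq (fun j => allowed cs (size sg + j)) (N - size sg).
have nthE n : size sg <= n -> n < N -> nth false (sg ++ rh) n = allowed cs n.
  move=> le lt; rewrite nth_cat ltnNge le /= nth_mkseq; last by lia.
  by rewrite subnKC.
exists (pickle rh); rewrite /growing_ext decK; apply/andP; split.
  apply/goodP => n Hn; have := nth_lt_size Hn; rewrite size_cat size_mkseq => Ln.
  case: (ltnP n (size sg)) => le; first by apply: gs; move: Hn; rewrite nth_cat le.
  by rewrite -nthE //; lia.
apply/allP => i; rewrite mem_iota /= => /HN [n [le lt an ni]].
apply/hasP; exists n; first by rewrite mem_iota size_cat size_mkseq /=; lia.
by rewrite nthE // an le -ni eqxx.
Qed.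

Lemma valid_path :
  exists P, (forall s, (run P s).1.1) /\ (forall i, P i.*2 = chi (jump emptyset) i).
Proof.
(* The bits depend on the states they produce, so the states are defined first and [run P] is then
   shown to agree with them. *)
pose st s := iteri s (fun i q => stage i (choice_bit i q) q) (true, [::], [::]).
pose P n := if odd n then choice_bit n./2 (st n./2) else chi (jump emptyset) n./2.
have Podd i : P i.*2.+1 = choice_bit i (st i) by rewrite /P /= odd_double /= uphalf_double.
have run_st s : run P s = st s.
  by elim: s => // s IHs; rewrite -[run P _]/(stage s (P s.*2.+1) (run P s)) Podd IHs.
exists P; split=> [s|i]; last by rewrite /P odd_double doubleK.
(* The induction also carries that every chosen color is avoided infinitely often in its column,
   which allows all columns to grow. *)
suff [] : (run P s).1.1 /\ forall i, i < size (run P s).2 ->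
  infinite_set (fun x => f i x <> nth 0 (run P s).2 i) by [].
elim: s => // s [ok IH].
have Hcs i : i < size (run P s.+1).2 -> infinite_set (fun x => f i x <> nth 0 (run P s.+1).2 i).
  rewrite size_run => Hi; rewrite -[run P s.+1]/(stage s (P s.*2.+1) (run P s)) /= nth_cat size_run.
  case: ltnP => Hs; first by apply: IH; rewrite size_run.
  have -> : i = s by lia.
  by rewrite subnn /= Podd -run_st; apply: choice_bitP.
split=> //; rewrite -[run P s.+1]/(stage s (P s.*2.+1) (run P s)) /= ok /=.
have [|//|m] := @growing_ext_ex (mid s (P s.*2.+1) (run P s))
  (newcs (P s.*2.+1) (run P s)); last exact: witP.
rewrite /mid /extend; case: ifP => [/andP[] //|_].
exact/good_newcs/good_run.
Qed.

End Construction.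

(** * Computability of the construction *)

Section Computability.
Variables (f : nat -> nat -> nat).
Hypothesis hf : Comp emptyset (fun p : nat * nat => f p.1 p.2).

Section AnyOracle.
Variables (A : nset) (T : countType).

Lemma comp_unp (n : T -> nat) : Comp A n -> Comp A (fun x => unp (n x)).
Proof.
move=> Hn; rewrite /unp; comp; apply: comp_chead => //; exact: comp_ctail.
Qed.

Lemma comp_fval (n : T -> nat) : Comp A n -> Comp A (fun x => fval f (n x)).
Proof. by move=> Hn; apply: comp_app (comp_empty A hf) _; apply: comp_unp. Qed.

Lemma comp_allowed (cs : T -> seq nat) (n : T -> nat) :
  Comp A cs -> Comp A n -> Comp A (fun x => allowed f (cs x) (n x)).
Proof.
move=> Hc Hn; have Hu := comp_unp Hn.
by rewrite /allowed /npair; comp; apply: comp_fval.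
Qed.
End AnyOracle.

Lemma comp_good (A : nset) (T : countType) (cs : T -> seq nat) (t : T -> seq bool) :
  Comp A cs -> Comp A t -> Comp A (fun x => good f (cs x) (t x)).
Proof.
move=> Hc Ht; rewrite /good; comp.
  by apply: comp_app Ht _; comp.
by apply: comp_allowed; [apply: comp_app Hc _|]; comp.
Qed.

Lemma comp_grows (A : nset) (T : countType) (k m : T -> nat) (t : T -> seq bool) :
  Comp A k -> Comp A m -> Comp A t -> Comp A (fun x => grows (k x) (m x) (t x)).
Proof.
move=> Hk Hm Ht; rewrite /grows; comp.
- by apply: comp_app Ht _; comp.
- by apply: comp_app Hm _; comp.
- by apply: comp_unp; comp.
- by apply: comp_app Ht _; comp.
Qed.

Lemma comp_fresh (A : nset) (T : countType) (t : T -> seq bool) :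
  Comp A t -> Comp A (fun x => fresh f (t x)).
Proof. by move=> Ht; rewrite /fresh; comp; apply: comp_fval; comp. Qed.

Let J := jump emptyset.

Lemma comp_newcs (A : nset) (T : countType) (b : T -> bool) (st : T -> state) :
  Comp A b -> Comp A st -> Comp A (fun x => newcs f (b x) (st x)).
Proof. by move=> Hb Hs; rewrite /newcs; comp; apply: comp_fresh; comp. Qed.

Lemma comp_forcing_ext (A : nset) (T : countType) (s : T -> nat)
    (sg : T -> seq bool) (cs : T -> seq nat) (m : T -> nat) :
  Comp A s -> Comp A sg -> Comp A cs -> Comp A m ->
  Comp A (fun x => forcing_ext f (s x) (sg x) (cs x) (m x)).
Proof.
move=> Hs Hg Hc Hm; have Ht := comp_cat Hg (comp_dec Hm).
by rewrite /forcing_ext; comp; [apply: comp_good | apply: comp_converges].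
Qed.

Lemma comp_growing_ext (A : nset) (T : countType)
    (sg : T -> seq bool) (cs : T -> seq nat) (m : T -> nat) :
  Comp A sg -> Comp A cs -> Comp A m -> Comp A (fun x => growing_ext f (sg x) (cs x) (m x)).
Proof.
move=> Hg Hc Hm; have Ht := comp_cat Hg (comp_dec Hm).
by rewrite /growing_ext; comp; [apply: comp_good | apply: comp_grows; comp].
Qed.

Lemma comp_wit1 : Comp J (fun q : nat * seq bool * seq nat => wit (forcing_ext f q.1.1 q.1.2 q.2)).
Proof.
apply: comp_wit.
  exact: coded_prod (coded_prod coded_nat (coded_seq coded_bool)) (coded_seq coded_nat).
by apply: comp_forcing_ext; comp.
Qed.

Lemma comp_wit2 : Comp J (fun q : seq bool * seq nat => wit (growing_ext f q.1 q.2)).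
Proof.
apply: comp_wit; first exact: coded_prod (coded_seq coded_bool) (coded_seq coded_nat).
by apply: comp_growing_ext; comp.
Qed.

Section Stage.
Variables (A : nset) (T : countType).
Hypothesis HJ : Comp A (chi J).
Variables (s : T -> nat) (b : T -> bool) (st : T -> state).
Hypotheses (Hs : Comp A s) (Hb : Comp A b) (Hst : Comp A st).

Let Hcs : Comp A (fun x => newcs f (b x) (st x)) := comp_newcs Hb Hst.
Let Hsg : Comp A (fun x => (st x).1.2).
Proof. by comp. Qed.

Let Hw1 : Comp A (fun x => wit (forcing_ext f (s x) (st x).1.2 (newcs f (b x) (st x)))).
Proof. exact: comp_app (comp_trans HJ comp_wit1) (comp_pair (comp_pair Hs Hsg) Hcs). Qed.

Lemma comp_forces : Comp A (fun x => forces f (s x) (b x) (st x)).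
Proof. exact: comp_forcing_ext. Qed.

Lemma comp_mid : Comp A (fun x => mid f (s x) (b x) (st x)).
Proof.
rewrite /mid /extend; apply: comp_if comp_forces _ Hsg.
exact: comp_cat Hsg (comp_dec Hw1).
Qed.

Let Hw2 : Comp A (fun x => wit (growing_ext f (mid f (s x) (b x) (st x)) (newcs f (b x) (st x)))).
Proof. exact: comp_app (comp_trans HJ comp_wit2) (comp_pair comp_mid Hcs). Qed.

Lemma comp_stage : Comp A (fun x => stage f (s x) (b x) (st x)).
Proof.
have He := comp_growing_ext comp_mid Hcs Hw2.
rewrite /stage; apply: comp_pair Hcs; apply: comp_pair.
  by apply: comp_andb He; comp.
by apply: comp_if He _ comp_mid; apply: comp_cat comp_mid (comp_dec Hw2).
Qed.
End Stage.

Lemma comp_run (A : nset) (T : countType) (P : T -> nat -> bool) (n : T -> nat) :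
  Comp A (chi J) -> Comp A (fun q : T * nat => P q.1 q.2) -> Comp A n ->
  Comp A (fun x => run f (P x) (n x)).
Proof.
move=> HJ HP Hn; rewrite /run; comp.
by apply: comp_stage; comp; apply: (comp_app2 (h := P)); comp.
Qed.

Lemma chi_tree_choice_tree n :
  chi (tree_code (choice_tree f)) n = (pickle (dec n) == n) && choice_tree f (dec n).
Proof.
apply/chiP/andP => [[s [-> Ts]]|[/eqP E Ts]]; first by rewrite decK eqxx.
by exists (dec n).
Qed.

Lemma comp_choice_tree : Comp J (choice_tree f).
Proof.
have HJ : Comp J (chi J) by apply: comp_oracle; comp.
rewrite /choice_tree; comp.
- have -> : (fun x : seq bool => uphalf (size x)) = (fun x => (size x).+1./2) by [].
  by comp.
- by apply: comp_run; comp.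
Qed.

Lemma choice_tree_infinite : infinite_set (tree_code (choice_tree f)).
Proof.
have [P [P1 P2]] := valid_path f.
move=> n; exists (pickle (mkseq P n)); split.
  by rewrite -{1}(size_mkseq P n) size_le_pickle.
by exists (mkseq P n); split=> //; apply: choice_tree_of_path.
Qed.

(** The notion of domination speaks of trees of degree exactly 0'. The tree is computable from 0' as
    the construction is; conversely any sufficiently long string in it displays a given bit of
    0'. *)
Lemma choice_tree_equiv : Tequiv (tree_code (choice_tree f)) J.
Proof.
split; apply/TreducibleP.
  have -> : chi (tree_code (choice_tree f)) = fun n => (pickle (dec n) == n) && choice_tree f (dec n).
    by apply: funext => n; apply: chi_tree_choice_tree.
  have Hd : Comp J dec by apply: comp_dec; comp.
  by comp; apply: comp_app comp_choice_tree _.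
(* [m] codes a string of the tree long enough to have a bit at position [n.*2]. *)
pose b n m := (pickle (dec m) == m) && choice_tree f (dec m) && (n.*2 < size (dec m)).
have Hex n : exists m, b n m.
  have [s ss Ts] := infinite_tree_level (fun s n => @choice_tree_take f s n)
    choice_tree_infinite n.*2.+1.
  by exists (pickle s); rewrite /b decK eqxx Ts ss ltnSn.
have Hw : Comp (tree_code (choice_tree f)) (fun n => wit (b n)).
  apply: (comp_mu (b := b) coded_nat).
  - have -> : (fun p : nat * nat => b p.1 p.2) = fun p =>
        chi (tree_code (choice_tree f)) p.2 && (p.1.*2 < size (dec p.2)).
      by apply: funext => p; rewrite chi_tree_choice_tree.
    by comp; apply: comp_dec; comp.
  - by move=> n; have [m] := Hex n; apply: witP.
  - by move=> n m; apply: wit_le.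
have -> : chi J = fun n => nth false (dec (wit (b n))) n.*2.
  apply: funext => n; have [m /witP] := Hex n.
  rewrite /b => /andP[/andP[_ /andP[/allP H _]] L]; apply/esym/eqP/H.
  by rewrite mem_iota /=; lia.
by comp; apply: comp_dec.
Qed.

(** The even bits of [P] yield 0', which together with the odd bits reproduces the construction and
    hence its decisions about the jump. *)
Lemma choice_tree_path_solution P : is_path (choice_tree f) P -> exists A : nat -> nset,
  (forall i, infinite_set (A i) /\ thin_for (A i) (f i)) /\
  Treducible (jump (seq_code A)) (path_set P).
Proof.
move=> /choice_tree_path [Pok Peven]; exists (solution f P); split=> [i|].
  by split; [apply: solution_infinite | apply: solution_thin].
apply/TreducibleP.
have HP : Comp (path_set P) P.
  have E : chi (path_set P) = P by apply: funext => n; apply/chiP/idP.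
  by rewrite -[X in Comp _ X]E; apply: comp_oracle; comp.
have HJ : Comp (path_set P) (chi J).
  have -> : chi J = fun i => P i.*2 by apply: funext.
  by apply: comp_app HP _; comp.
have -> : chi (jump (seq_code (solution f P))) = fun e => forces f e (P e.*2.+1) (run f P e).
  by apply: funext => e; apply: jump_solution.
apply: comp_forces => //; comp.
  by apply: comp_app HP _; comp.
by apply: comp_run; comp; apply: comp_app HP _; comp.
Qed.

End Computability.

(** * The two conclusions *)

Lemma computable_fseq_comp f : computable_fseq f ->
  Comp emptyset (fun p : nat * nat => f p.1 p.2).
Proof.
by case=> p Hp; apply: (eval_comp (coded_prod coded_nat coded_nat) (p := p)) => -[i x]; apply: Hp.
Qed.

Lemma Treducible_empty A : Treducible emptyset A.
Proof.
apply/TreducibleP; apply: comp_empty; by apply: comp_oracle; comp.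
Qed.

Theorem theorem5p16 :
  (forall D : nset, dom_deg D (jump emptyset) ->
     forall f : nat -> nat -> nat, computable_fseq f ->
       exists A : nat -> nset,
         (forall i, infinite_set (A i) /\ thin_for (A i) (f i)) /\
         Treducible (jump (seq_code A)) D)
  /\
  (forall f : nat -> nat -> nat, computable_fseq f ->
     exists A : nat -> nset,
       (forall i, infinite_set (A i) /\ thin_for (A i) (f i)) /\
       Tequiv (jump (jump (seq_code A))) (jump (jump emptyset))).
Proof.
have tree f : is_tree (choice_tree f) by move=> s n; apply: choice_tree_take.
split=> [D domD f|f] /computable_fseq_comp hf.
  have [P [pathP PD]] := domD _ (tree f) (@choice_tree_infinite f) (choice_tree_equiv hf).
  have [A [HA AP]] := choice_tree_path_solution hf pathP.
  by exists A; split=> //; apply: Treducible_trans AP PD.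
have [P pathP PT] := low_basis (tree f) (@choice_tree_infinite f).
have [A [HA AP]] := choice_tree_path_solution hf pathP.
(* The lower bound on the double jump is monotonicity of the jump, applied twice. *)
exists A; split=> //; split; last by do 2 apply: jump_mono; apply: Treducible_empty.
(* The upper bound passes from the double jump of the solution to the jump of [P], then to the jump
   of the tree, then to 0''. *)
apply: Treducible_trans (jump_mono AP) (Treducible_trans PT (jump_mono _)).
by case: (choice_tree_equiv hf).
Qed.
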